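(* Let $\Pi=(\Pi_n)_{n\ge1}$ be an exchangeable random partition of $\mathbb{N}$ with EPPF $\mathfrak{q}$, let $(Z_n)_{n\ge1}$ be i.i.d. random variables with law $H$ on a Polish space $\mathbb{X}$, independent of $\Pi$, and let $\tilde\Pi=(\tilde\Pi_n)_{n\ge1}$ be the random partition induced by the sequence $\xi_n=Z_{\mathscr{C}_n(\Pi)}$, $n\ge1$ (which is a $gSSS(\mathfrak{q},H)$). Let $\mathbb{X}_0=\{\bar x_1,\bar x_2,\dots\}$ be the set of atoms of $H$, $\bar a_j=H(\{\bar x_j\})$, $a=H(\mathbb{X}_0)>0$, $a_j=\bar a_j/a$, and for $x>0$ let $\alpha(x)=\#\{j:a_j\ge1/x\}$. Assume that there are a deterministic sequence $(c_n)_{n\geq 1}$ of positive numbers with $c_n\to+\infty$ and a strictly positive random variable $S$ such that $|\Pi_n|/c_n\to S$ a.s., and that $\alpha(x)=x^{\sigma_0}\ell_0^*(x)$, where $0\le\sigma_0\le1$ and $\ell_0^*$ is a slowly varying function at $+\infty$ (with $\lim_{x\to+\infty}\ell_0^*(x)=+\infty$ if $\sigma_0=0$). Then $$\frac{|\tilde\Pi_n|}{c_n}\to(1-a)S\quad\text{a.s. if } a<1,$$ and $$\frac{|\tilde\Pi_n|}{c_n^{\sigma_0}\ell_0(c_n)}\to z_0S^{\sigma_0}\quad\text{a.s. if } a=1,$$ where $\ell_0(x)=\ell_0^*(x)$ and $z_0=\Gamma(1-\sigma_0)$ if $0\le\sigma_0<1$, while $\ell_0(x)=\int_x^{+\infty}u^{-1}\ell_0^*(u)\,du<+\infty$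 and $z_0=1$ if $\sigma_0=1$.
   Context: A random partition of $\mathbb{N}$ is a sequence $\Pi=(\Pi_n)_{n\ge1}$ of random partitions of $[n]=\{1,\dots,n\}$ consistent under restriction, with blocks $\Pi_{1,n},\Pi_{2,n},\dots$ listed in increasing order of smallest elements; $|\Pi_n|$ is the number of blocks. It is exchangeable if the law of each $\Pi_n$ is invariant under permutations of $[n]$; its EPPF is the symmetric function $\mathfrak{q}$ with $P\{\Pi_n=\pi_n\}=\mathfrak{q}(|\pi_{1,n}|,\dots,|\pi_{k,n}|)$ for each partition $\pi_n$ of $[n]$ with $k$ blocks. $\mathscr{C}_n(\Pi)=c$ if $n\in\Pi_{c,n}$. The random partition induced by $(\xi_n)$ is given by $i\sim j$ iff $\xi_i=\xi_j$. A $gSSS(\mathfrak{q},H)$ is a sequence conditionally i.i.d. given a random probability measure of the form $\sum_jp_j\delta_{Y_j}$ with $(Y_j)$ i.i.d. from $H$, independent of weights $(p_j)$ in $[0,1]$ with $\sum_jp_j=1$ a.s. whose decreasing rearrangement corresponds to $\mathfrak{q}$ via Kingman's correspondence. Standing assumption: the a.s. limits $p_j^\downarrow$ of (the $j$-th largest block size of $\Pi_n$)$/n$ satisfy $\sum_jp_j^\downarrow=1$ a.s. *)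

(* Defs.v *)
From HB Require Import structures.
From mathcomp Require Import all_boot all_order all_algebra.
From mathcomp Require Import all_fingroup finmap.
From mathcomp Require Import all_classical all_reals all_analysis.

Set Implicit Arguments.
Unset Strict Implicit.
Unset Printing Implicit Defensive.

Import Order.TTheory GRing.Theory Num.Theory.
Import numFieldNormedType.Exports.

Local Open Scope classical_set_scope.
Local Open Scope ring_scope.

(* All indices are shifted by one: the set [n] = {1, ..., n} is 'I_n, the first
   block, the first random variable and the largest block size have index 0. *)

Section FinitePartitions.
Variable n : nat.
Implicit Types (A : {set 'I_n}) (pi : {set {set 'I_n}}).

(* The smallest element of A when A is nonempty, because enum 'I_n is
   increasing. *)
Definition least A : nat := find (fun i => i \in A) (enum 'I_n).

Definition ordered_blocks pi : seq {set 'I_n} :=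
  sort (fun A B => (least A <= least B)%N) (enum pi).

Definition block_sizes pi : seq nat := [seq #|A| | A <- ordered_blocks pi].

Definition ranked_size pi (j : nat) : nat := nth 0%N (sort geq (block_sizes pi)) j.

Definition permute_partition (s : 'S_n) pi : {set {set 'I_n}} :=
  [set (s @: A)%SET | A : {set 'I_n} in pi]%SET.

Definition restrict_partition (m : nat) (mn : (m <= n)%N) pi : {set {set 'I_m}} :=
  ([set (widen_ord mn @^-1: A)%SET | A : {set 'I_n} in pi] :\ finset.set0)%SET.

End FinitePartitions.

Section RandomPartitions.
Context {d : measure_display} {Omega : measurableType d} {R : realType}.
Variable P : probability Omega R.
Variable Pi : forall n, Omega -> {set {set 'I_n}}.

Definition random_partition : Prop :=
  [/\ forall n (pi : {set {set 'I_n}}), measurable (@Pi n @^-1` [set pi]),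
      forall n w, finset.partition (Pi n w) [set: 'I_n]%SET
    & forall m n (mn : (m <= n)%N) w,
        restrict_partition mn (Pi n w) = Pi m w].

Definition exchangeable : Prop :=
  forall n (s : 'S_n) (pi : {set {set 'I_n}}),
    P ((fun w => permute_partition s (Pi n w)) @^-1` [set pi]) =
    P (@Pi n @^-1` [set pi]).

Definition is_eppf (q : seq nat -> R) : Prop :=
  (forall s t : seq nat, all (ltn 0%N) s -> perm_eq s t -> q s = q t) /\
  (forall n (pi : {set {set 'I_n}}), (0 < n)%N -> finset.partition pi [set: 'I_n]%SET ->
     P (@Pi n @^-1` [set pi]) = (q (block_sizes pi))%:E).

(* p is the sequence of asymptotic frequencies of the blocks, ranked in
   decreasing order of size. *)
Definition proper_frequencies : Prop :=
  {ae P, forall w, exists p : nat -> R,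
    (forall j, (ranked_size (Pi n w) j)%:R / n%:R @[n --> \oo] --> p j) /\
    series p @ \oo --> (1 : R)}.

(* Index of the block of the (i+1)-st integer among the blocks of its own
   partition of [i+1]. *)
Definition block_index (i : nat) (w : Omega) : nat :=
  index (finset.pblock (Pi i.+1 w) ord_max) (ordered_blocks (Pi i.+1 w)).

Definition sigma_partition : set (set Omega) :=
  <<s [set A | exists n (pi : {set {set 'I_n}}), A = @Pi n @^-1` [set pi]] >>.

End RandomPartitions.

Definition induced_partition (X : eqType) (xi : nat -> X) (n : nat) :
    {set {set 'I_n}} :=
  finset.preim_partition (fun i : 'I_n => xi i) [set: 'I_n]%SET.

Definition polish (R : realType) (X : topologicalType) : Prop :=
  exists dist : X -> X -> R,
    [/\ [/\ forall x y, 0 <= dist x y,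
            forall x y, dist x y = 0 <-> x = y,
            forall x y, dist x y = dist y x
          & forall x y z, dist x z <= dist x y + dist y z],
        forall (x : X) (A : set X),
          nbhs x A <-> exists2 e : R, 0 < e & [set y | dist x y < e] `<=` A,
        forall u : nat -> X,
          (forall e : R, 0 < e -> exists N : nat, forall m n : nat,
             (N <= m)%N -> (N <= n)%N -> dist (u m) (u n) < e) ->
          exists l : X, u @ \oo --> l
      & exists2 D : set X, countable D & dense D].

Notation borel X := (g_sigma_algebraType (@open X)).

Section Independence.
Context {d : measure_display} {Omega : measurableType d} {R : realType}.
Variable P : probability Omega R.

Definition independent_systems (F G : set (set Omega)) : Prop :=
  forall A B, F A -> G B -> P (A `&` B) = (P A * P B)%E.

Definition sigma_sequence {d' : measure_display} {T : measurableType d'}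
    (Z : nat -> Omega -> T) : set (set Omega) :=
  <<s [set A | exists n, exists2 B, measurable B & A = Z n @^-1` B] >>.

Definition mutually_independent {d' : measure_display} {T : measurableType d'}
    (Z : nat -> Omega -> T) : Prop :=
  forall (J : {fset nat}) (B : nat -> set T), (forall j, measurable (B j)) ->
    P (\bigcap_(j in [set` J]) (Z j @^-1` B j)) =
    (\prod_(j <- J) P (Z j @^-1` B j))%E.

Definition iid_with_law {d' : measure_display} {T : measurableType d'}
    (H : probability T R) (Z : nat -> {mfun Omega >-> T}) : Prop :=
  (forall n B, measurable B -> distribution P (Z n) B = H B) /\
  mutually_independent (fun n => Z n : Omega -> T).

End Independence.

Section Atoms.
Context {R : realType} {X : ptopologicalType}.
Variable H : probability (borel X) R.

Definition atoms : set (borel X) := [set y | (0 < H [set y])%E].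

Definition atomic_mass : R := fine (H atoms).

(* The set below is finite for every x > 0 when H has an atom, as the masses of
   the atoms are summable; fset_set is therefore used within its domain. *)
Definition atom_count (x : R) : nat :=
  #|` fset_set [set y | atoms y /\ 1 / x <= fine (H [set y]) / atomic_mass] |.

End Atoms.

Section Asymptotics.
Context {R : realType}.
Implicit Types (sigma x : R) (l : R -> R).

Definition slowly_varying l : Prop :=
  (exists2 A : R, measurable_fun `[A, +oo[ l & forall x, A <= x -> 0 < l x) /\
  (forall lambda : R, 0 < lambda -> l (lambda * x) / l x @[x --> +oo] --> (1 : R)).

Definition Gamma x : R :=
  \int[lebesgue_measure]_(t in `]0, +oo[) (t `^ (x - 1) * expR (- t)).

(* Rintegral is 0 when the integral is infinite, so finiteness has to be asserted
   separately. *)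
Definition ell0 sigma l x : R :=
  if sigma == 1 then \int[lebesgue_measure]_(u in `[x, +oo[) (u^-1 * l u)
  else l x.

Definition z0 sigma : R := if sigma == 1 then 1 else Gamma (1 - sigma).

End Asymptotics.

(* Main.v *)
Require Import Defs.
From mathcomp Require Import all_boot all_order all_algebra.
From mathcomp Require Import all_fingroup finmap.
From mathcomp Require Import all_classical all_reals all_analysis.
From mathcomp Require Import measurable_realfun.
From mathcomp Require Import ring lra.

Set Implicit Arguments.
Unset Strict Implicit.
Unset Printing Implicit Defensive.

Import Order.TTheory GRing.Theory Num.Theory.
Import numFieldNormedType.Exports.

Local Open Scope classical_set_scope.
Local Open Scope ring_scope.

(** In the list of blocks by increasing least element, an integer that opens a
    block receives the first index not used so far. Hence the indices used up to
    time [n] are those below the number [K] of blocks of [Pi n], and the induced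
    partition has as many blocks as there are distinct values among
    [Z 0, ..., Z (K - 1)] ([size_undup_block_indices]). This holds path by path,
    so it is enough to know how the number [D m] of distinct values among the
    first [m] samples grows for almost every path, and to substitute for [m] the
    number of blocks, which tends to infinity like [c n * S].

    If [a < 1], the samples outside the atoms are almost surely all different
    (by Fubini's theorem, as the diagonal of a Polish space is measurable), and
    by the law of large numbers they form a proportion [1 - a] of all samples.
    The other samples take at most [J] values, apart from those among the atoms
    of rank at least [J], whose proportion is small when [J] is large. Hence
    [D m / m] tends to [1 - a] ([distinct_sample_linear]).

    If [a = 1], let [p] be the sequence of masses of the atoms. The mean of [D m]
    is the sum over [j] of [1 - (1 - p j) ^+ m], called [occupancy p m]. The
    events that two given atoms have been seen are negatively correlated, so the
    variance of [D m] is at most its mean, and [D m / occupancy p m] tends to [1]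
    almost surely: Chebyshev's bounds are summable along the times at which the
    mean passes the squares, and monotonicity fills the gaps
    ([occurrence_strong_law], [distinct_sample_strong_law]).

    What remains is Karlin's analysis of [occupancy p m]. Write [V x] for the
    number of [j] with [p j >= 1 / x], which is [alpha x]. Replacing [(1 - p j) ^+ m]
    by [expR (- (m * p j))] changes the sum by a factor that tends to [1], and turns
    it into the integral over [t > 0] of [expR (- t) * V (m / t)]. For
    [sigma0 < 1], regular variation makes [V (m / t) / V m] converge to
    [t `^ (- sigma0)], a domination of Potter's type allows the passage to the
    limit, and the quotient of the integral by [V m] tends to
    [Gamma (1 - sigma0)] ([occupancy_frequent_asymp]). For [sigma0 = 1] the
    limiting integral diverges at zero. The correct scale is then the sum [L m]
    of the [Num.min (m * p j) 1], which is [m] times the integral of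
    [u ^- 2 * V u] over [u >= m], that is [m * ell0 m]. Indeed [V] is negligible
    before [L], whereas the terms of [L m] and of [occupancy p m] differ
    appreciably only at indices counted by [V (x * m)] for a fixed [x]
    ([occupancy_capped_asymp]).

    Finally [V] and [L] are monotone and regularly varying, so their quotient
    between the number of blocks and [c n] tends to the power [sigma0] of [S]
    ([regularly_varying_comp]). *)

(** * Series of nonnegative terms *)

Section Tsum.
Variable R : realType.
Implicit Types f g : nat -> R.

Definition nnsummable f :=
  (forall j, 0 <= f j) /\ (\sum_(j <oo) (f j)%:E < +oo)%E.

(** The sum is formed in the extended reals, where Tonelli's theorem applies to
    every nonnegative series, and only then read as a real number. *)
Definition tsum f : R := fine (\sum_(j <oo) (f j)%:E)%E.

Lemma tsumE f : nnsummable f -> (tsum f)%:E = (\sum_(j <oo) (f j)%:E)%E.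
Proof.
move=> [f0 foo]; rewrite /tsum fineK// ge0_fin_numE//.
by apply: nneseries_ge0 => j _ _; rewrite lee_fin.
Qed.

Lemma tsum_ge0 f : (forall j, 0 <= f j) -> 0 <= tsum f.
Proof.
by move=> f0; apply/fine_ge0/nneseries_ge0 => j _ _; rewrite lee_fin.
Qed.

Lemma le_nnsummable f g :
  (forall j, 0 <= f j <= g j) -> nnsummable g -> nnsummable f.
Proof.
move=> fg [g0 goo]; split=> [j|]; first by have /andP[] := fg j.
apply: le_lt_trans goo; apply: lee_nneseries => j; rewrite ?lee_fin.
  by move=> _; have /andP[] := fg j.
by have /andP[] := fg j.
Qed.

Lemma le_tsum f g : nnsummable f -> nnsummable g ->
  (forall j, f j <= g j) -> tsum f <= tsum g.
Proof.
move=> sf sg fg; rewrite -lee_fin !tsumE//.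
by apply: lee_nneseries => j; rewrite lee_fin ?sf.1// => _; rewrite lee_fin.
Qed.

Lemma nnsummableD f g : nnsummable f -> nnsummable g ->
  nnsummable (f \+ g).
Proof.
move=> [f0 foo] [g0 goo]; split=> [j|]; first exact: addr_ge0.
under eq_eseriesr do rewrite EFinD.
by rewrite nneseriesD ?lte_add_pinfty// => j; rewrite lee_fin.
Qed.

Lemma tsumD f g : nnsummable f -> nnsummable g ->
  tsum (f \+ g) = tsum f + tsum g.
Proof.
move=> sf sg; apply: EFin_inj; rewrite EFinD !tsumE//; last exact: nnsummableD.
under eq_eseriesr do rewrite EFinD.
by rewrite nneseriesD// => j _ _; rewrite lee_fin ?sf.1 ?sg.1.
Qed.

Lemma nnsummableZ (k : R) f : 0 <= k -> nnsummable f ->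
  nnsummable (fun j => k * f j).
Proof.
move=> k0 [f0 foo]; split=> [j|]; first exact: mulr_ge0.
under eq_eseriesr do rewrite EFinM.
rewrite nneseriesZl => [|j _]; last by rewrite lee_fin.
by rewrite -tsumE//= -EFinM ltry.
Qed.

Lemma tsumZ (k : R) f : 0 <= k -> nnsummable f ->
  tsum (fun j => k * f j) = k * tsum f.
Proof.
move=> k0 sf; apply: EFin_inj; rewrite EFinM !tsumE//; last exact: nnsummableZ.
under eq_eseriesr do rewrite EFinM.
by rewrite nneseriesZl// => j _; rewrite lee_fin sf.1.
Qed.

(** A cardinality written as a series of indicators: this is how counts of
    distinct values come under the linearity of the expectation. *)
Lemma nneseries_mem_uniq (s : seq nat) : uniq s ->
  (\sum_(j <oo) ((j \in s)%:R : R)%:E = (size s)%:R%:E)%E.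
Proof.
elim: s => [_|i s IH /= /andP[iNs us]].
  by rewrite eseries0// => j _ _; rewrite in_nil.
under eq_eseriesr => j _.
  have -> : ((j \in i :: s)%:R : R)%:E = ((j == i)%:R%:E + (j \in s)%:R%:E)%E.
    rewrite inE -EFinD; case: eqP => [->|_] /=; last by rewrite add0r.
    by rewrite (negbTE iNs) addr0.
  over.
rewrite nneseriesD// IH//; [|by move=> j _ _; rewrite lee_fin..].
rewrite (nneseriesD1 (n := i)) => [|k _|//]; last by rewrite lee_fin.
rewrite eqxx eseries0 => [|j _ /= /negbTE -> //].
by rewrite adde0 -EFinD addrC natr1.
Qed.

Lemma nnsummable_mem (s : seq nat) : uniq s ->
  nnsummable (fun j => (j \in s)%:R : R).
Proof. by move=> us; split=> [j|]//; rewrite nneseries_mem_uniq// ltry. Qed.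

Lemma tsum_mem_uniq (s : seq nat) : uniq s ->
  tsum (fun j => (j \in s)%:R) = (size s)%:R.
Proof. by move=> us; rewrite /tsum nneseries_mem_uniq. Qed.

Lemma nnsummable_cvg0 (f : nat -> R) : nnsummable f -> f k @[k --> \oo] --> 0.
Proof.
move=> [f0 foo].
have tail := nneseries_tail_cvg foo (fun k _ => f0 k).
suff : (f k)%:E @[k --> \oo] --> 0%:E by move=> /fine_cvg.
apply: squeeze_cvge (cvg_cst 0%E) tail.
near=> k; rewrite lee_fin f0/=.
have := @nneseries_lim_ge R (fun k => (f k)%:E) xpredT k k.+1.
by rewrite big_nat1; apply => j _ _; rewrite lee_fin.
Unshelve. all: by end_near. Qed.

(** Comparison with the telescoping series of differences of [2 / k]. *)
Lemma inv_sqr_summable : nnsummable (fun k => (k.+1%:R ^+ 2)^-1 : R).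
Proof.
split=> [k|]; first by rewrite invr_ge0 sqr_ge0.
pose f k : R := - 2 / k.+1%:R.
apply: (@le_lt_trans _ _ (\sum_(0 <= k <oo) ((f k.+1)%:E - (f k)%:E))%E).
  apply: lee_nneseries => k; first by rewrite lee_fin invr_ge0 sqr_ge0.
  move=> _; rewrite -EFinB lee_fin /f.
  have k0 : 0 < k%:R + 1 :> R by rewrite ltr_pwDr.
  have k1 : 0 < k%:R + 2 :> R by rewrite ltr_pwDr.
  rewrite -(natr1 k.+1) -(natr1 k) -addrA -/2.
  rewrite (_ : _ - _ = 2 / ((k%:R + 2) * (k%:R + 1))); last first.
    by field; rewrite !gt_eqF.
  rewrite ler_pdivlMr ?mulr_gt0// mulrC ler_pdivrMr ?exprn_gt0// expr2 mulrA.
  rewrite ler_pM2r//.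
  have : 0 <= k%:R :> R by [].
  lra.
have fc : f k @[k --> \oo] --> 0.
  rewrite -(mulr0 (- 2)); apply: cvgM; first exact: cvg_cst.
  exact: cvg_harmonic.
have lf : limn (EFin \o f) = 0%E.
  apply/cvg_lim => //; apply: cvg_EFin; first exact: nearW.
  exact: fc.
rewrite (@nondecreasing_telescope_sumey _ _ f) ?lf//.
  by rewrite -EFinB ltry.
move=> k l kl; rewrite /f !mulNr lerN2 ler_pM2l// lef_pV2 ?posrE//.
by rewrite ler_nat ltnS.
Qed.

End Tsum.

(** * Regular variation *)

Section RegularVariation.
Variable R : realType.
Implicit Types V : R -> R.

Definition regularly_varying (sigma : R) V :=
  forall lambda : R, 0 < lambda ->
    V (lambda * x) / V x @[x --> +oo] --> lambda `^ sigma.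

Lemma pinfty_threshold (Q : R -> Prop) : (\forall x \near +oo, Q x) ->
  exists2 x0, 0 < x0 & forall x, x0 <= x -> Q x.
Proof.
move=> [M [_ MQ]]; exists (Num.max M 0 + 1) => [|x Mx].
  by rewrite ltr_wpDl// le_max lexx orbT.
by apply: MQ; apply: lt_le_trans Mx; rewrite ltr_pwDr// le_max lexx.
Qed.

Lemma cvg_powR (T : Type) (F : set_system T) (FF : Filter F) (f : T -> R)
    (s r : R) : 0 < s -> f x @[x --> F] --> s -> f x `^ r @[x --> F] --> s `^ r.
Proof.
move=> s0 fs.
have lnf : ln (f x) @[x --> F] --> ln s.
  by apply: (cvg_comp f (@ln R) fs); exact: continuous_ln.
have expln : expR (r * ln (f x)) @[x --> F] --> expR (r * ln s).
  apply: (cvg_comp (fun x => r * ln (f x)) expR); last exact: continuous_expR.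
  by apply: cvgM => //; exact: cvg_cst.
rewrite /powR (gt_eqF s0).
apply: cvg_trans expln; apply: near_eq_cvg.
apply: filterS (cvgr_gt _ fs _ s0) => x fx0 /=.
by rewrite (gt_eqF fx0).
Qed.

(** Monotonicity replaces the uniform convergence theorem: [z n] eventually lies
    between [(s - d) * y n] and [(s + d) * y n], and pointwise regular variation
    at these two factors is enough. *)
Lemma regularly_varying_comp (sigma : R) V (y z : nat -> R) (s : R) :
  (forall u v, 0 < u -> u <= v -> V u <= V v) ->
  (\forall x \near +oo, 0 < V x) ->
  regularly_varying sigma V ->
  y @ \oo --> +oo -> z n / y n @[n --> \oo] --> s -> 0 < s ->
  V (z n) / V (y n) @[n --> \oo] --> s `^ sigma.
Proof.
move=> Vmono Vpos Vrv yoo zys s0.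
have y0 : \forall n \near \oo, 0 < y n by apply: (cvgryPgt y).1.
have Vy0 : \forall n \near \oo, 0 < V (y n) by exact: (yoo _ Vpos).
apply/cvgrPdist_lt => e e0.
have e20 : 0 < e / 2 by rewrite divr_gt0.
have /cvgrPdist_lt/(_ _ e20) : u `^ sigma @[u --> s] --> s `^ sigma.
  by apply: cvg_powR => //; exact: cvg_id.
move=> /nbhs_normP[del /= del0 dels].
pose d := Num.min (del / 2) (s / 2).
have d0 : 0 < d by rewrite lt_min !divr_gt0.
have ddel : d < del.
  by rewrite gt_min; apply/orP; left; lra.
have ds : d < s.
  by rewrite gt_min; apply/orP; right; lra.
have lo : `|s `^ sigma - (s - d) `^ sigma| < e / 2.
  by apply: dels; rewrite /= opprB addrCA subrr addr0 gtr0_norm.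
have hi : `|s `^ sigma - (s + d) `^ sigma| < e / 2.
  by apply: dels; rewrite /= opprD addrA subrr add0r normrN gtr0_norm.
have sd0 : 0 < s - d by rewrite subr_gt0.
have sd1 : 0 < s + d by rewrite addr_gt0.
have /cvgrPdist_lt/(_ _ e20) Vlo :
    V ((s - d) * y n) / V (y n) @[n --> \oo] --> (s - d) `^ sigma.
  by apply: (cvg_comp y (fun x => V ((s - d) * x) / V x) yoo); exact: Vrv.
have /cvgrPdist_lt/(_ _ e20) Vhi :
    V ((s + d) * y n) / V (y n) @[n --> \oo] --> (s + d) `^ sigma.
  by apply: (cvg_comp y (fun x => V ((s + d) * x) / V x) yoo); exact: Vrv.
near=> n.
have yn0 : 0 < y n by near: n.
have Vyn0 : 0 < V (y n) by near: n.
have zlo : (s - d) * y n <= z n.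
  rewrite -ler_pdivlMr//; apply/ltW; near: n.
  by apply: (cvgr_gt _ zys); rewrite ltrBlDr ltrDl.
have zhi : z n <= (s + d) * y n.
  rewrite -ler_pdivrMr//; apply/ltW; near: n.
  by apply: (cvgr_lt _ zys); rewrite ltrDl.
have z0 : 0 < z n by apply: lt_le_trans zlo; rewrite mulr_gt0.
have A : V ((s - d) * y n) / V (y n) <= V (z n) / V (y n).
  by rewrite ler_pM2r ?invr_gt0// Vmono// mulr_gt0.
have B : V (z n) / V (y n) <= V ((s + d) * y n) / V (y n).
  by rewrite ler_pM2r ?invr_gt0// Vmono.
have : `|(s - d) `^ sigma - V ((s - d) * y n) / V (y n)| < e / 2 by near: n.
have : `|(s + d) `^ sigma - V ((s + d) * y n) / V (y n)| < e / 2 by near: n.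
move: lo hi A B.
rewrite !ltr_norml => /andP[? ?] /andP[? ?] ? ? /andP[? ?] /andP[? ?].
apply/andP; split; lra.
Unshelve. all: by end_near. Qed.

Lemma bernoulli_ineq (t : R) n : t <= 1 -> 1 - n%:R * t <= (1 - t) ^+ n.
Proof.
move=> t1; elim: n => [|n IH]; first by rewrite mul0r subr0 expr0.
have t1' : 0 <= 1 - t by rewrite subr_ge0.
have nt : 0 <= n%:R * t ^+ 2 :> R by rewrite mulr_ge0// sqr_ge0.
rewrite exprS -natr1; apply: le_trans (ler_wpM2l t1' IH).
lra.
Qed.

(** Iterating [V (2 * y) < theta * V y] beyond a threshold. For a nondecreasing
    [V] this controls every dilation, which is all that remains of Potter's
    bounds. *)
Lemma dyadic_potter (sigma theta : R) (V : R -> R) :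
  (\forall x \near +oo, 0 < V x) -> regularly_varying sigma V ->
  2 `^ sigma < theta ->
  exists2 x0, 0 < x0 & forall x, x0 <= x ->
    0 < V x /\ forall k, V (2 ^+ k * x) <= theta ^+ k * V x.
Proof.
move=> Vpos Vrv theta2.
have Vlt : \forall x \near +oo, V (2 * x) / V x < theta.
  exact: (cvgr_lt _ (Vrv 2 _)).
have : \forall x \near +oo, 0 < V x /\ V (2 * x) / V x < theta by near do split.
move=> /pinfty_threshold[x0 x00 MV]; exists x0 => // x Mx.
have P (y : R) : x <= y -> 0 < V y /\ V (2 * y) / V y < theta.
  by move=> xy; apply: MV; exact: le_trans xy.
have theta0 : 0 <= theta by apply/ltW/le_lt_trans/theta2/powR_ge0.
have x_ge0 : 0 <= x by apply: le_trans Mx; exact: ltW.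
split=> [|k]; first by have [] := P x (lexx x).
elim: k => [|k IH]; first by rewrite !expr0 !mul1r.
have [Vk0] := P (2 ^+ k * x) (ler_peMl x_ge0 (exprn_ege1 _ (ler1n _ 2))).
rewrite mulrA -exprS ltr_pdivrMr// => /ltW /le_trans; apply.
by rewrite exprS -mulrA ler_wpM2l.
Unshelve. all: by end_near. Qed.

Lemma slowly_varying_regularly_varying (sigma : R) (V l : R -> R) :
  (forall x, 0 < x -> V x = x `^ sigma * l x) -> slowly_varying l ->
  (\forall x \near +oo, 0 < V x) /\ regularly_varying sigma V.
Proof.
move=> Vl [[A _ lpos] lsv]; split.
  near=> x; have x0 : 0 < x by near: x; exact: nbhs_pinfty_gt.
  rewrite Vl// mulr_gt0 ?powR_gt0// lpos//; near: x; exact: nbhs_pinfty_ge.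
move=> lambda lambda0.
have : lambda `^ sigma * (l (lambda * x) / l x) @[x --> +oo] --> lambda `^ sigma.
  rewrite -[X in _ --> X]mulr1; apply: cvgM; [exact: cvg_cst|exact: lsv].
apply: cvg_trans; apply: near_eq_cvg; near=> x.
have x0 : 0 < x by near: x; exact: nbhs_pinfty_gt.
have xs : 0 < x `^ sigma by exact: powR_gt0.
rewrite !Vl ?mulr_gt0// powRM ?ltW// invfM.
rewrite -!mulrA; congr (_ * _); rewrite [RHS]mulrCA mulrA.
by rewrite -mulrA mulVKf// gt_eqF.
Unshelve. all: by end_near. Qed.

(** Beyond a threshold each doubling of [x] multiplies [V x] by more than
    [1 + d], because [2 `^ sigma > 1]. *)
Lemma regularly_varying_unbounded (sigma : R) (V : R -> R) : 0 < sigma ->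
  (\forall x \near +oo, 0 < V x) -> regularly_varying sigma V ->
  forall A, exists2 x, 0 < x & A <= V x.
Proof.
move=> s0 Vpos Vrv A.
have pow1 : 1 < 2 `^ sigma :> R.
  by rewrite /powR pnatr_eq0/= -[ltLHS]expR0 ltr_expR mulr_gt0// ln_gt0// ltr1n.
pose d := (2 `^ sigma - 1) / 2.
have d0 : 0 < d by rewrite divr_gt0// subr_gt0.
have d2 : 1 + d < 2 `^ sigma by rewrite /d; lra.
have Vgt : \forall x \near +oo, 1 + d < V (2 * x) / V x.
  by apply: (cvgr_gt _ (Vrv 2 _) _ d2).
have [|x x0 Q] := @pinfty_threshold
    (fun y => 0 < V y /\ 1 + d < V (2 * y) / V y); first by near do split.
have Vx0 : 0 < V x by have [] := Q x (lexx x).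
have grow k : (1 + d) ^+ k * V x <= V (2 ^+ k * x).
  elim: k => [|k IH]; first by rewrite !expr0 !mul1r.
  have [Vk0] := Q (2 ^+ k * x) (ler_peMl (ltW x0) (exprn_ege1 _ (ler1n _ 2))).
  rewrite mulrA -exprS ltr_pdivlMr// => /ltW; apply: le_trans.
  by rewrite exprS -mulrA ler_wpM2l// addr_ge0// ltW.
pose k := Num.bound (`|A| / (d * V x)).
exists (2 ^+ k * x); first by rewrite mulr_gt0// exprn_gt0.
apply: le_trans (grow k); apply: le_trans (ler_norm A) _.
have kd : `|A| <= k%:R * (d * V x).
  have dV : 0 < d * V x by exact: mulr_gt0.
  by rewrite -ler_pdivrMr//; apply/ltW/archi_boundP/divr_ge0 => //; exact: ltW.
have : 1 + k%:R * d <= (1 + d) ^+ k.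
  have Nd : - d <= 1 by rewrite lerNl (le_trans _ (ltW d0)).
  by have := bernoulli_ineq k Nd; rewrite mulrN !opprK.
rewrite -(ler_pM2r Vx0); apply: le_trans.
by rewrite mulrDl mul1r (le_trans kd)// mulrA lerDr ltW.
Unshelve. all: by end_near. Qed.

(** The quotient is the product of [D / occ] and [occ / W] at [K n] and of
    [W (K n) / W (c n)]. In the application [D m] counts distinct values among
    [m] samples, [occ m] is its mean, and [K n] is the number of blocks. *)
Lemma growth_along_index (D occ : nat -> R) (W : R -> R) (z sigma s : R)
    (K : nat -> nat) (c : nat -> R) :
  (forall u v, 0 < u -> u <= v -> W u <= W v) -> (\forall x \near +oo, 0 < W x) ->
  regularly_varying sigma W -> (\forall m \near \oo, 0 < occ m) ->
  D m / occ m @[m --> \oo] --> (1 : R) -> occ m / W m%:R @[m --> \oo] --> z ->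
  c @ \oo --> +oo -> (K n)%:R / c n @[n --> \oo] --> s -> 0 < s ->
  K @ \oo --> \oo ->
  D (K n) / W (c n) @[n --> \oo] --> z * s `^ sigma.
Proof.
move=> Wmono Wpos Wrv occ0 Docc occW coo Kcs s0 Koo.
have DK : D (K n) / occ (K n) @[n --> \oo] --> (1 : R).
  by apply: (cvg_comp K (fun m => D m / occ m) Koo).
have oK : occ (K n) / W (K n)%:R @[n --> \oo] --> z.
  by apply: (cvg_comp K (fun m => occ m / W m%:R) Koo).
have WK := regularly_varying_comp Wmono Wpos Wrv coo Kcs s0.
have : D (K n) / occ (K n) * (occ (K n) / W (K n)%:R) * (W (K n)%:R / W (c n))
    @[n --> \oo] --> 1 * z * s `^ sigma.
  by apply: cvgM => //; exact: cvgM.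
rewrite mul1r; apply: cvg_trans; apply: near_eq_cvg.
have KR : (K n)%:R @[n --> \oo] --> (+oo : set_system R) by apply/cvgrnyP.
near=> n.
have o0 : 0 < occ (K n) by near: n; exact: (Koo _ occ0).
have W0 : 0 < W (K n)%:R by near: n; exact: (KR _ Wpos).
by rewrite /= -!mulrA !mulKf// gt_eqF.
Unshelve. all: by end_near. Qed.

Lemma index_cvg_infty (K : nat -> nat) (c : nat -> R) (s : R) :
  c @ \oo --> +oo -> (K n)%:R / c n @[n --> \oo] --> s -> 0 < s ->
  K @ \oo --> \oo.
Proof.
move=> coo Kc s0; apply/(@cvgrnyP R); apply/cvgryPge => A.
have s20 : s / 2 < s by lra.
have lo : \forall n \near \oo, s / 2 < (K n)%:R / c n by apply: (cvgr_gt _ Kc).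
near=> n.
have c0 : 0 < c n by near: n; apply: (cvgryPgt c).1.
have : s / 2 * c n < (K n)%:R by rewrite -ltr_pdivlMr//; near: n.
move=> /ltW; apply: le_trans; rewrite mulrC -ler_pdivrMr ?divr_gt0//.
by near: n; apply: (cvgryPge c).1.
Unshelve. all: by end_near. Qed.

End RegularVariation.

(** * Expected numbers of distinct values in a sample *)

Section ElementaryIntegrals.
Variable R : realType.
Local Notation mu := (@lebesgue_measure R).

Lemma continuous_expRN : continuous (fun t : R => expR (- t)).
Proof.
move=> t; apply: (cvg_comp -%R expR (opp_continuous t)); exact: continuous_expR.
Qed.

Lemma measurable_expRN (D : set R) : measurable_fun D (fun t : R => expR (- t)).
Proof.
by apply: measurable_funTS; apply: continuous_measurable_fun continuous_expRN.
Qed.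

Lemma integral_expRN_itv (c : R) : 0 <= c ->
  (\int[mu]_(t in `]0%R, c]) (expR (- t))%:E = (1 - expR (- c))%:E)%E.
Proof.
rewrite le_eqVlt => /predU1P[<-|c0].
  by rewrite set_itv_ge ?integral_set0 ?oppr0 ?expR0 ?subrr// bnd_simp ltxx.
rewrite integral_itv_obnd_cbnd; last first.
  by apply/measurable_EFinP; exact: measurable_expRN.
rewrite (@continuous_FTC2 _ _ (fun t => - expR (- t))) //.
- by rewrite oppr0 expR0 -EFinB opprK addrC.
- exact: continuous_subspaceT continuous_expRN.
- split.
  + move=> x _; exact: ex_derive.
  + by apply: cvg_at_right_filter; apply: cvgN; exact: continuous_expRN.
  + by apply: cvg_at_left_filter; apply: cvgN; exact: continuous_expRN.
- move=> x _; rewrite derive1E derive_val; ring.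
Qed.

Lemma integral_expRN_itvy :
  (\int[mu]_(t in `]0%R, +oo[) (expR (- t))%:E = 1)%E.
Proof.
rewrite integral_itv_obnd_cbnd; last first.
  by apply/measurable_EFinP; exact: measurable_expRN.
rewrite (@ge0_continuous_FTC2y _ _ (fun t => - expR (- t)) 0 0) //.
- by rewrite oppr0 expR0 -EFinB opprK add0r.
- exact: continuous_subspaceT continuous_expRN.
- by rewrite -oppr0; apply: cvgN; exact: cvgr_expR.
- by apply: cvg_at_right_filter; apply: cvgN; exact: continuous_expRN.
- move=> x _; rewrite derive1E derive_val; ring.
Qed.

Lemma integral_sqrV_itvy (c : R) : 0 < c ->
  (\int[mu]_(u in `[c, +oo[) (u ^- 2)%:E = (c^-1)%:E)%E.
Proof.
move=> c0.
have dV (x : R) : c < x -> is_derive x 1 (fun t => - t^-1) (x ^- 2).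
  move=> cx; have x0 : x != 0 by rewrite gt_eqF// (lt_trans c0).
  have := is_deriveN (@is_deriveV _ id x 1 1 x0 (is_derive_id x 1)).
  by rewrite scaleNr opprK /= -[_ *: _]/(_ * 1) mulr1.
rewrite (@ge0_continuous_FTC2y _ _ (fun t => - t^-1) c 0) //.
- by rewrite -EFinB opprK add0r.
- by move=> x _; rewrite invr_ge0 sqr_ge0.
- apply: continuous_in_subspaceT => x; rewrite inE/= in_itv/= andbT => cx.
  have x0 : x != 0 by rewrite gt_eqF// (lt_le_trans c0).
  apply: cvgV; first by rewrite expf_neq0.
  exact: exprn_continuous.
- by rewrite -oppr0; apply: cvgN; apply/gtr0_cvgV0 => //; exact: nbhs_pinfty_gt.
- by move=> x /dV dx; exact: ex_derive.
- apply: cvg_at_right_filter; apply: cvgN; apply: cvgV; last exact: cvg_id.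
  by rewrite gt_eqF.
- by move=> x; rewrite in_itv/= andbT => /dV dx; rewrite derive1E derive_val.
Qed.

End ElementaryIntegrals.

Section Occupancy.
Variables (R : realType) (p : nat -> R).
Hypotheses (sp : nnsummable p) (p_le1 : forall j, p j <= 1).
Local Notation mu := (@lebesgue_measure R).

(** With [p] the masses of the points, [occupancy m] is the mean number of points
    seen in [m] independent draws, and [poisson_occupancy x] the mean number seen
    when the number of draws is Poisson of mean [x]. *)
Definition frequent_count (x : R) : R := tsum (fun j => (1 / x <= p j)%R%:R).
Definition capped_mass (x : R) : R := tsum (fun j => Num.min (x * p j) 1).
Definition poisson_occupancy (x : R) : R := tsum (fun j => 1 - expR (- (x * p j))).
Definition occupancy (m : nat) : R := tsum (fun j => 1 - (1 - p j) ^+ m).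

Let p_ge0 j : 0 <= p j. Proof. exact: sp.1. Qed.

Lemma summable_frequent x : 0 < x -> nnsummable (fun j => (1 / x <= p j)%R%:R : R).
Proof.
move=> x0; apply: le_nnsummable (nnsummableZ (ltW x0) sp) => j.
rewrite ler0n/= div1r; case: (leP x^-1) => [xp|_]; last by rewrite mulr_ge0// ltW.
by rewrite -ler_pdivrMl// mulr1.
Qed.

Lemma summable_capped x : 0 < x -> nnsummable (fun j => Num.min (x * p j) 1).
Proof.
move=> x0; apply: le_nnsummable (nnsummableZ (ltW x0) sp) => j.
by rewrite ge_min lexx/= le_min ler01 andbT mulr_ge0// ltW.
Qed.

Lemma summable_poisson x : 0 < x -> nnsummable (fun j => 1 - expR (- (x * p j))).
Proof.
move=> x0; apply: le_nnsummable (nnsummableZ (ltW x0) sp) => j.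
have xp0 : 0 <= x * p j by rewrite mulr_ge0// ltW.
rewrite subr_ge0 expR_le1 oppr_le0 xp0 lerBlDr -lerBlDl.
exact: expR_ge1Dx.
Qed.

Lemma occupancy_term_ge0 m j : 0 <= 1 - (1 - p j) ^+ m.
Proof.
by rewrite subr_ge0 exprn_ile1// ?subr_ge0// gerBl.
Qed.

Lemma summable_occupancy m : nnsummable (fun j => 1 - (1 - p j) ^+ m).
Proof.
apply: le_nnsummable (nnsummableZ (ler0n R m) sp) => j.
by rewrite occupancy_term_ge0 /= lerBlDr -lerBlDl; exact: bernoulli_ineq.
Qed.

Lemma occupancy0 : occupancy 0 = 0.
Proof.
rewrite /occupancy /tsum eseries0//= => j _ _.
by rewrite expr0 subrr.
Qed.

Lemma frequent_count_ge0 x : 0 <= frequent_count x.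
Proof. by apply: tsum_ge0 => j; rewrite ler0n. Qed.

Lemma le_frequent_count x y : 0 < x -> x <= y -> frequent_count x <= frequent_count y.
Proof.
move=> x0 xy; have y0 : 0 < y by apply: lt_le_trans xy.
apply: le_tsum; [exact: summable_frequent..|] => j.
case: (leP (1 / x)) => [xp|_]; last by rewrite ler0n.
by rewrite (le_trans _ xp)// !div1r lef_pV2.
Qed.

Lemma le_capped_mass x y : 0 < x -> x <= y -> capped_mass x <= capped_mass y.
Proof.
move=> x0 xy; have y0 : 0 < y by apply: lt_le_trans xy.
apply: le_tsum; [exact: summable_capped..|] => j.
by rewrite le_min ge_min ge_min lexx orbT andbT ler_wpM2r.
Qed.

Lemma frequent_le_capped x : 0 < x -> frequent_count x <= capped_mass x.
Proof.
move=> x0; apply: le_tsum; [exact: summable_frequent|exact: summable_capped|].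
move=> j; rewrite le_min lern1 leq_b1 andbT div1r.
case: (leP x^-1) => [xp|_]; last by rewrite mulr_ge0// ltW.
by rewrite -ler_pdivrMl// mulr1.
Qed.

Lemma integral_mul_bool (D : set R) (f : R -> R) (b : R -> bool) :
  (\int[mu]_(u in D) (f u * (b u)%:R)%:E =
   \int[mu]_(u in D `&` [set u | b u]) (f u)%:E)%E.
Proof.
rewrite integral_mkcondr; apply: eq_integral => u _; rewrite patchE mem_setE.
by rewrite -[u \in b]/(b u); case: (b u); rewrite ?mulr1 ?mulr0.
Qed.

(** Tonelli's theorem: an integral against [frequent_count] is computed weight
    by weight, each one giving an elementary integral over an interval. *)
Lemma integral_frequent_count (D : set R) (f g : R -> R) :
  measurable D -> measurable_fun D f -> (forall u, D u -> 0 <= f u) ->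
  measurable_fun D (fun u => 1 / g u) -> (forall u, D u -> 0 < g u) ->
  (\int[mu]_(u in D) (f u * frequent_count (g u))%:E =
   \sum_(j <oo) \int[mu]_(u in D `&` [set u | (1 / g u <= p j)%R]) (f u)%:E)%E.
Proof.
move=> mD mf f0 mg g0.
transitivity (\int[mu]_(u in D) \sum_(j <oo) (f u * (1 / g u <= p j)%R%:R)%:E)%E.
  apply: eq_integral => u; rewrite inE => Du.
  under [RHS]eq_eseriesr do rewrite EFinM.
  rewrite EFinM tsumE; last exact/summable_frequent/g0.
  by rewrite nneseriesZl// => j _; rewrite lee_fin.
rewrite integral_nneseries//.
- by apply: eq_eseriesr => j _; rewrite integral_mul_bool.
- move=> j; apply/measurable_EFinP; apply: measurable_funM => //.
  apply: (measurableT_comp (f := fun b : bool => b%:R : R)) => //.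
  exact: measurable_fun_ler.
- by move=> j u Du; rewrite lee_fin mulr_ge0// f0.
Qed.

Lemma measurable_frequent_count (D : set R) (g : R -> R) :
  measurable_fun D (fun u => 1 / g u) -> (forall u, D u -> 0 < g u) ->
  measurable_fun D (fun u => frequent_count (g u)).
Proof.
move=> mg g0; apply/measurable_EFinP.
pose h j u : \bar R := ((1 / g u <= p j)%R%:R)%:E.
apply: (@eq_measurable_fun _ _ _ _ _ (fun u => \sum_(j <oo) h j u)%E).
  by move=> u; rewrite inE => /g0 gu0 /=; rewrite tsumE//; exact: summable_frequent.
apply: (@ge0_emeasurable_sum _ _ _ D h xpredT) => [j u _ _|j _].
  by rewrite /h lee_fin ler0n.
apply/measurable_EFinP.
apply: (measurableT_comp (f := fun b : bool => b%:R : R)) => //.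
exact: measurable_fun_ler.
Qed.

(** The weight [p j] contributes the integral of [u ^- 2] over [u] above both [x]
    and [(p j)^-1]. When [sigma0 = 1], the left-hand side is the integral defining
    [ell0], since [frequent_count p u = u * lstar u]. *)
Lemma capped_mass_integral (x : R) : 0 < x ->
  (\int[mu]_(u in `[x, +oo[) (u ^- 2 * frequent_count u)%:E =
   (x^-1 * capped_mass x)%:E)%E.
Proof.
move=> x0.
have mV (f : R -> R) : {in `[x, +oo[, continuous f} -> measurable_fun `[x, +oo[ f.
  move=> cf; apply: subspace_continuous_measurable_fun => //.
  by apply: continuous_in_subspaceT => u; rewrite inE => /cf.
have gtx (u : R) : `[x, +oo[%classic u -> 0 < u.
  by rewrite /= in_itv/= andbT; exact: lt_le_trans.
have cV (n : nat) : {in `[x, +oo[, continuous (fun u : R => u ^- n)}.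
  move=> u ux; apply: cvgV; last exact: exprn_continuous.
  by rewrite expf_neq0// gt_eqF// gtx.
rewrite integral_frequent_count//; last 3 first.
- exact: mV.
- by move=> u _; rewrite invr_ge0 sqr_ge0.
- apply: mV => u ux; under eq_fun do rewrite div1r.
  exact: (cV 1%N).
rewrite EFinM tsumE; last exact: summable_capped.
rewrite -nneseriesZl => [|j _]; last first.
  by rewrite lee_fin le_min ler01 andbT mulr_ge0// ltW.
apply: eq_eseriesr => j _.
have [p0|pn0] := eqVneq (p j) 0.
  rewrite p0 mulr0 min_l// mule0 (_ : _ `&` _ = set0) ?integral_set0//.
  rewrite -subset0 => u [/gtx u0] /=.
  by rewrite div1r leNgt invr_gt0 u0.
have pj0 : 0 < p j by rewrite lt_def pn0 p_ge0.
have -> : `[x, +oo[ `&` [set u | 1 / u <= p j] = `[Num.max x (p j)^-1, +oo[%classic.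
  apply/seteqP; split=> u /=; rewrite !in_itv/= !andbT ge_max.
    move=> [xu]; have u0 : 0 < u by exact: lt_le_trans xu.
    by rewrite xu/= div1r -[X in _ <= X]invrK lef_pV2// posrE invr_gt0.
  move=> /andP[xu pu]; split=> //; have u0 : 0 < u by exact: lt_le_trans xu.
  by rewrite div1r -[X in _ <= X]invrK lef_pV2// posrE invr_gt0.
rewrite integral_sqrV_itvy; last by rewrite lt_max x0.
rewrite -EFinM; congr EFin.
have [xp|px] := leP x (p j)^-1.
  rewrite invrK min_l; first by rewrite mulKf// gt_eqF.
  by rewrite -[leRHS](mulVf pn0) ler_pM2r.
rewrite min_r ?mulr1// ltW//.
by rewrite -[ltLHS](mulVf pn0) ltr_pM2r.
Qed.

(** [1 - expR (- (x * p j))] is the integral of [expR (- t)] over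
    [0 < t <= x * p j], and this last condition says that [p j] is counted by
    [frequent_count (x / t)]. *)
Lemma poisson_occupancy_integral (x : R) : 0 < x ->
  (\int[mu]_(t in `]0%R, +oo[) (expR (- t) * frequent_count (x / t))%:E =
   (poisson_occupancy x)%:E)%E.
Proof.
move=> x0.
have gt0 (u : R) : `]0, +oo[%classic u -> 0 < u by rewrite /= in_itv/= andbT.
have E t : 1 / (x / t) = t / x by rewrite div1r invf_div.
rewrite integral_frequent_count//; last 3 first.
- exact: measurable_expRN.
- rewrite (_ : (fun u => _) = (fun t : R => t / x)); last exact/funext.
  exact: mulrr_measurable.
- by move=> u /gt0 u0; rewrite divr_gt0.
rewrite tsumE; last exact: summable_poisson.
apply: eq_eseriesr => j _.
have -> : `]0, +oo[ `&` [set t | 1 / (x / t) <= p j] = `]0, x * p j]%classic.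
  apply/seteqP; split=> t /=; rewrite !in_itv/= ?andbT E ler_pdivrMr// (mulrC (p j)).
    by move=> [-> ->].
  by move=> /andP[-> ->].
by rewrite integral_expRN_itv// mulr_ge0// ltW.
Qed.

Lemma poisson_le_occupancy (m : nat) : (0 < m)%N ->
  poisson_occupancy m%:R <= occupancy m.
Proof.
move=> m0; apply: le_tsum; [|exact: summable_occupancy|].
  by apply: summable_poisson => //; rewrite ltr0n.
move=> j; rewrite lerD2l lerN2 -mulrN expRM_natl lerXn2r ?nnegrE ?expR_ge0 ?subr_ge0//.
exact: expR_ge1Dx.
Qed.

(** With [y = m * p j], the inequality [expR (- p) * (1 - p ^+ 2) <= 1 - p] and
    Bernoulli's inequality show that the two terms differ by at most
    [y ^+ 2 * expR (- y) / m], and [expR y >= 1 + y ^+ 2 / 2] bounds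
    [y ^+ 2 * expR (- y)] by twice the Poisson term. *)
Lemma occupancy_le_poisson (m : nat) : (0 < m)%N ->
  occupancy m <= (1 + 2 / m%:R) * poisson_occupancy m%:R.
Proof.
move=> m0; have m0' : 0 < m%:R :> R by rewrite ltr0n.
have c0 : 0 <= 1 + 2 / m%:R :> R by rewrite addr_ge0// divr_ge0.
have sm := summable_poisson m0'.
rewrite -tsumZ//; apply: le_tsum; [exact: summable_occupancy|exact: nnsummableZ|].
move=> j; set y := m%:R * p j.
have y0 : 0 <= y by rewrite mulr_ge0.
have y2 : y ^+ 2 * expR (- y) <= 2 * (1 - expR (- y)).
  have := ler_wpM2r (expR_ge0 (- y)) (expR_ge1Dxn 1 y0).
  by rewrite -expRD subrr expR0 (_ : 2`!%:R = 2 :> R)//; lra.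
have psq : expR (- p j) * (1 - p j ^+ 2) <= 1 - p j.
  have h : expR (- p j) * (1 + p j) <= 1.
    have := ler_wpM2l (expR_ge0 (- p j)) (expR_ge1Dx (p j)).
    by rewrite -expRD addNr expR0.
  rewrite -subr_ge0 (_ : _ - _ = (1 - p j) * (1 - expR (- p j) * (1 + p j))); last ring.
  by rewrite mulr_ge0 ?subr_ge0.
have p2 : p j ^+ 2 <= 1 by rewrite expr_le1.
have : expR (- y) * (1 - m%:R * p j ^+ 2) <= (1 - p j) ^+ m.
  have -> : expR (- y) = expR (- p j) ^+ m by rewrite /y -mulrN expRM_natl.
  apply: le_trans (ler_wpM2l _ (bernoulli_ineq m p2)) _.
    by rewrite exprn_ge0// expR_ge0.
  rewrite -exprMn lerXn2r ?nnegrE//; last by rewrite subr_ge0.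
  by rewrite mulr_ge0 ?expR_ge0// subr_ge0.
have -> : m%:R * p j ^+ 2 = y ^+ 2 / m%:R by rewrite /y; field; rewrite gt_eqF.
have : m%:R^-1 * (y ^+ 2 * expR (- y)) <= m%:R^-1 * (2 * (1 - expR (- y))).
  by rewrite ler_wpM2l// invr_ge0 ltW.
lra.
Qed.

(** A point of mass at least [1 / m] is missed in [m] draws with probability at
    most [expR (- 1) <= 1 / 2]. This makes the mean number of distinct values
    unbounded as soon as [frequent_count] is. *)
Lemma occupancy_ge_frequent m : (0 < m)%N ->
  2^-1 * frequent_count m%:R <= occupancy m.
Proof.
move=> m0; have m0' : 0 < m%:R :> R by rewrite ltr0n.
have h0 : 0 <= 2^-1 :> R by rewrite invr_ge0.
have sV := summable_frequent m0'.
rewrite -tsumZ//; apply: le_tsum; [exact: nnsummableZ|exact: summable_occupancy|].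
move=> j; case: (leP (1 / m%:R)) => [mp|_]; last by rewrite mulr0 occupancy_term_ge0.
rewrite mulr1.
have mp1 : 1 <= m%:R * p j by rewrite -ler_pdivrMl// mulr1 -div1r.
have h : (1 - p j) ^+ m <= expR (- (m%:R * p j)).
  rewrite -mulrN expRM_natl lerXn2r ?nnegrE ?expR_ge0 ?subr_ge0//.
  exact: expR_ge1Dx.
have : expR (- (m%:R * p j)) <= 2^-1.
  rewrite expRN lef_pV2 ?posrE ?expR_gt0//.
  by apply: le_trans (expR_ge1Dx _); rewrite (natrD _ 1 1) lerD2l.
lra.
Qed.

End Occupancy.

(** * Index of regular variation below one *)

Section KarlinGamma.
Variables (R : realType) (p : nat -> R) (sigma : R).
Hypotheses (sp : nnsummable p) (p_le1 : forall j, p j <= 1).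
Local Notation mu := (@lebesgue_measure R).
Local Notation V := (frequent_count p).
Local Notation posR := (`]0, +oo[%classic : set R).
Hypothesis sigma1 : sigma < 1.
Hypothesis Vpos : \forall x \near +oo, 0 < V x.
Hypothesis Vrv : regularly_varying sigma V.

(** Any number strictly between [2 `^ sigma] and [2] would do: the lower bound is
    for [dyadic_potter], the upper one for the integrability of [dom]. *)
Let theta : R := (2 `^ sigma + 2) / 2.

Let powlt2 : 2 `^ sigma < 2 :> R.
Proof.
rewrite -[ltRHS]lnK ?posrE// /powR pnatr_eq0/= ltr_expR.
by rewrite gtr_pMl// ln_gt0// ltr1n.
Qed.

Let theta2 : theta < 2. Proof. by move: powlt2; rewrite /theta; lra. Qed.

Let sigma_theta : 2 `^ sigma < theta.
Proof. by move: powlt2; rewrite /theta; lra. Qed.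

Let theta0 : 0 < theta.
Proof. exact/le_lt_trans/sigma_theta/powR_ge0. Qed.

(** A bound for [expR (- t) * (V (x / t) / V x)], uniform in large [x]. The first
    term serves for [t >= 1]; for [t] between [2 ^- k.+1] and [2 ^- k] the dilation
    factor [t^-1] is at most [2 ^+ k.+1], so the ratio is at most
    [theta ^+ k.+1]. The integral is a geometric series of ratio [theta / 2]. *)
Let dom (t : R) : \bar R :=
  ((expR (- t))%:E + \sum_(k <oo) (theta ^+ k.+1 * (t < 2 ^- k)%R%:R)%:E)%E.

Let dom_integrable : mu.-integrable posR dom.
Proof.
have mb k : measurable_fun posR (fun t : R => (t < 2 ^- k)%R%:R : R).
  apply: (measurableT_comp (f := fun b : bool => b%:R : R)) => //.
  exact: measurable_fun_ltr.
have mterm k : measurable_fun posR (fun t => (theta ^+ k.+1 * (t < 2 ^- k)%R%:R)%:E).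
  by apply/measurable_EFinP; exact: measurable_funM.
have mseries : measurable_fun posR
    (fun t => \sum_(k <oo) (theta ^+ k.+1 * (t < 2 ^- k)%R%:R)%:E)%E.
  apply: (@ge0_emeasurable_sum _ _ _ _ _ xpredT) => [k t _ _|k _].
    by rewrite lee_fin mulr_ge0// exprn_ge0// ltW.
  exact: mterm.
have D0 : forall (t : R), (0 <= \sum_(k <oo) (theta ^+ k.+1 * (t < 2 ^- k)%R%:R)%:E)%E.
  by move=> t; apply: nneseries_ge0 => k _ _; rewrite lee_fin mulr_ge0// exprn_ge0// ltW.
apply: integrableD => //.
  apply/integrableP; split; first by apply/measurable_EFinP; exact: measurable_expRN.
  under eq_integral do rewrite abse_EFin ger0_norm ?expR_ge0//.
  by rewrite integral_expRN_itvy ltry.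
apply/integrableP; split => //.
under eq_integral do rewrite gee0_abs//.
rewrite integral_nneseries//; last first.
  by move=> k t _; rewrite lee_fin mulr_ge0// exprn_ge0// ltW.
have E k : (\int[mu]_(t in `]0%R, +oo[) (theta ^+ k.+1 * (t < 2 ^- k)%R%:R)%:E
    = (geometric theta (theta / 2) k)%:E)%E.
  rewrite (@integral_mul_bool _ _ (cst (theta ^+ k.+1))).
  have -> : `]0, +oo[ `&` [set t | t < 2 ^- k] = `]0, 2 ^- k[%classic :> set R.
    apply/seteqP; split=> t /=; rewrite !in_itv/= ?andbT.
      by move=> [-> ->].
    by move=> /andP[-> ->].
  rewrite (integral_cst mu _ (theta ^+ k.+1)%:E)//= lebesgue_measure_itv/=.
  rewrite lte_fin invr_gt0 exprn_gt0//.
  by rewrite oppr0 adde0 -EFinM exprS -mulrA -exprVn -exprMn.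
under eq_eseriesr do rewrite E.
have tn : `|theta / 2| < 1.
  by rewrite ger0_norm ?divr_ge0 ?ltW// ltr_pdivrMr// mul1r.
rewrite (cvg_lim _ (_ : _ --> (theta / (1 - theta / 2))%:E)%E)// ?ltry//.
under eq_fun do rewrite sumEFin.
apply: cvg_EFin; first exact: nearW.
exact: cvg_geometric_series.
Qed.

Lemma frequent_ratio_dominated x0 : 0 < x0 ->
  (forall x, x0 <= x -> 0 < V x /\ forall k, V (2 ^+ k * x) <= theta ^+ k * V x) ->
  forall x t, x0 <= x -> 0 < t ->
  (`|(expR (- t) * (V (x / t) / V x))%:E| <= dom t)%E.
Proof.
move=> x00 potter x t x0x t0; have [Vx0 Vk] := potter x x0x.
have x_gt0 : 0 < x by exact: lt_le_trans x0x.
have ex2 : exists k, t^-1 <= 2 ^+ k.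
  by exists (Num.bound t^-1); apply/ltW/upper_nthrootP.
have ub k : t^-1 <= 2 ^+ k -> V (x / t) / V x <= theta ^+ k.
  move=> tk; rewrite ler_pdivrMr//; apply: le_trans (Vk k).
  apply: le_frequent_count => //; first by rewrite divr_gt0.
  by rewrite mulrC ler_pM2r.
have r0 : 0 <= V (x / t) / V x by rewrite divr_ge0// frequent_count_ge0.
rewrite abse_EFin ger0_norm; last exact: mulr_ge0 (expR_ge0 _) r0.
have S0 k : (0 <= (theta ^+ k.+1 * (t < 2 ^- k)%R%:R)%:E)%E.
  by rewrite lee_fin mulr_ge0// exprn_ge0// ltW.
case: (ex_minnP ex2) => -[|k] tk kmin.
  rewrite -[leLHS]adde0 leeD ?nneseries_ge0// lee_fin ler_piMr ?expR_ge0//.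
  by rewrite -(expr0 theta) ub.
have tk' : t < 2 ^- k.
  rewrite -[ltLHS]invrK ltf_pV2 ?posrE ?invr_gt0 ?exprn_gt0//.
  by rewrite ltNge; apply/negP => /kmin; rewrite ltnn.
rewrite -[leLHS]add0e leeD ?lee_fin ?expR_ge0//.
apply: (@le_trans _ _ (theta ^+ k.+1 * (t < 2 ^- k)%R%:R)%:E).
  rewrite lee_fin tk' mulr1; apply: le_trans (ub _ tk).
  by rewrite ler_piMl// expR_le1 oppr_le0 ltW.
by rewrite (nneseriesD1 (n := k))// leeDl// nneseries_ge0.
Qed.

(** Dominated convergence in [poisson_occupancy_integral], divided by [V m]: the
    integrand converges to [expR (- t) * t `^ (- sigma)]. *)
Lemma poisson_occupancy_asymp :
  poisson_occupancy p m%:R / V m%:R @[m --> \oo] --> Gamma (1 - sigma).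
Proof.
have [x0 x00 potter] := dyadic_potter Vpos Vrv sigma_theta.
(* The sequence is shifted so that the domination holds from index zero on. *)
pose N := Num.bound x0.
pose y n : R := (n + N)%:R.
have yx0 n : x0 <= y n.
  by rewrite (le_trans (ltW (archi_boundP (ltW x00))))// ler_nat leq_addl.
have yoo : y n @[n --> \oo] --> +oo.
  have := (@cvg_shiftn N _ (fun n => n%:R : R) +oo); rewrite /= => ->.
  exact: cvgr_idn.
have y0 n : 0 < y n by exact: lt_le_trans (yx0 n).
have posRP (t : R) : posR t -> 0 < t by rewrite /= in_itv/= andbT.
rewrite -(cvg_shiftn N).
pose f_ n t : \bar R := (expR (- t) * (V (y n / t) / V (y n)))%:E.
pose f t : \bar R := (t `^ (1 - sigma - 1) * expR (- t))%:E.
have mfreq n : measurable_fun posR (fun t => V (y n / t)).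
  apply: measurable_frequent_count => // [|t /posRP t0]; last by rewrite divr_gt0.
  rewrite (_ : (fun u => _) = (fun t : R => t / y n)).
    exact: mulrr_measurable.
  by apply/funext => t; rewrite div1r invf_div.
have mef n : measurable_fun posR (fun t => (expR (- t) * V (y n / t))%:E).
  by apply/measurable_EFinP; apply: measurable_funM; first exact: measurable_expRN.
have mf_ n : measurable_fun posR (f_ n).
  apply/measurable_EFinP; apply: measurable_funM; first exact: measurable_expRN.
  by apply: measurable_funM.
have mf : measurable_fun posR f.
  apply/measurable_EFinP; apply: measurable_funM; last exact: measurable_expRN.
  by apply: measurable_funTS; exact: measurable_powR.
have f_f : {ae mu, forall t, posR t -> f_ ^~ t @ \oo --> f t}.
  apply: aeW => t /posRP t0; apply: cvg_EFin; first exact: nearW.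
  rewrite /= [X in _ --> X]mulrC; apply: cvgM; first exact: cvg_cst.
  have -> : t `^ (1 - sigma - 1) = t^-1 `^ sigma.
    rewrite (_ : 1 - sigma - 1 = -1 * sigma); last ring.
    by rewrite powRrM powR_inv1// ltW.
  under eq_fun do rewrite [y _ / t]mulrC.
  apply: (cvg_comp y (fun x => V (t^-1 * x) / V x) yoo).
  by apply: Vrv; rewrite invr_gt0.
have f_g : {ae mu, forall t n, posR t -> (`|f_ n t| <= dom t)%E}.
  by apply: aeW => t n /posRP t0; exact: (frequent_ratio_dominated x00 potter).
have [fint _] := @dominated_convergence _ _ _ mu posR (measurable_itv _) f_ f dom
  mf_ mf f_f dom_integrable f_g.
have -> : [sequence \int[mu]_(t in posR) f_ n t]_n%E =
    fun n => (poisson_occupancy p (y n) / V (y n))%:E.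
  apply/funext => n /=.
  under eq_integral do rewrite /f_ mulrA EFinM.
  rewrite ge0_integralZr//.
  - by rewrite poisson_occupancy_integral.
  - exact: mef.
  - by move=> t _; rewrite lee_fin mulr_ge0 ?expR_ge0 ?frequent_count_ge0.
  - by rewrite lee_fin invr_ge0 frequent_count_ge0.
rewrite -[X in _ --> X -> _]fineK; last exact: integrable_fin_num.
by move=> /fine_cvg.
Qed.

(** The mean number of points seen in [m] draws lies between the Poissonized mean
    and [1 + 2 / m] times the latter. *)
Lemma occupancy_frequent_asymp :
  occupancy p m / V m%:R @[m --> \oo] --> Gamma (1 - sigma).
Proof.
have ub : (1 + 2 / m%:R) * (poisson_occupancy p m%:R / V m%:R) @[m --> \oo]
    --> Gamma (1 - sigma).
  rewrite -[X in _ --> X]mul1r; apply: cvgM; last exact: poisson_occupancy_asymp.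
  rewrite -[X in _ --> X]addr0; apply: cvgD; first exact: cvg_cst.
  rewrite -(mulr0 2); apply: cvgM; first exact: cvg_cst.
  apply/gtr0_cvgV0; last exact: cvgr_idn.
  by exists 1%N => // m /= m1; rewrite ltr0n.
apply: squeeze_cvgr poisson_occupancy_asymp ub.
exists 1%N => // m /= m1.
rewrite mulrA !ler_wpM2r ?invr_ge0 ?frequent_count_ge0 ?andbT//.
- exact: occupancy_le_poisson.
- exact: poisson_le_occupancy.
Qed.

End KarlinGamma.

(** * Index of regular variation equal to one *)

Section KarlinOne.
Variables (R : realType) (p : nat -> R).
Hypotheses (sp : nnsummable p) (p_le1 : forall j, p j <= 1).
Local Notation V := (frequent_count p).
Local Notation L := (capped_mass p).
Hypothesis Vpos : \forall x \near +oo, 0 < V x.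
Hypothesis Vrv : regularly_varying 1 V.

Let p_ge0 j : 0 <= p j. Proof. exact: sp.1. Qed.

Let inv_le_mass x j : 0 < x -> (1 / x <= p j) = (1 <= x * p j).
Proof. by move=> x0; rewrite div1r -[x^-1]mulr1 ler_pdivrMl. Qed.

(** Termwise, with [y = x * p j]: if [y >= 1] both sides are [1], and otherwise
    half of [Num.min (2 * y) 1] is at most [y]. As [V] nearly doubles when [x]
    does, iterating this makes [L] much larger than [V]. *)
Lemma capped_mass_halving x : 0 < x -> 2^-1 * V x + 2^-1 * L (2 * x) <= L x.
Proof.
move=> x0; have x20 : 0 < 2 * x by rewrite mulr_gt0.
have half0 : 0 <= 2^-1 :> R by rewrite invr_ge0.
have sV := nnsummableZ half0 (summable_frequent sp x0).
have sL := nnsummableZ half0 (summable_capped sp x20).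
rewrite -!tsumZ//; [|exact: summable_capped|exact: summable_frequent].
rewrite -tsumD//; apply: le_tsum; [exact: nnsummableD|exact: summable_capped|].
move=> j /=; have y0 : 0 <= x * p j by rewrite mulr_ge0// ltW.
rewrite inv_le_mass// -mulrA.
case: (leP 1 (x * p j)) => y1 /=; case: (leP (2 * (x * p j)) 1) => y2; lra.
Qed.

(** The cap at [1] commutes with the factor [lambda] at all indices where neither
    [x * p j] nor [lambda * x * p j] reaches [1], so only the frequent indices
    contribute to the difference. *)
Lemma capped_mass_scaling (lambda x : R) : 0 < lambda -> 0 < x ->
  `|lambda * L x - L (lambda * x)| <= (1 + lambda) * V (Num.max 1 lambda * x).
Proof.
move=> l0 x0; set M := Num.max 1 lambda.
have M0 : 0 < M by rewrite lt_max ltr01.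
have lx0 : 0 < lambda * x by rewrite mulr_gt0.
have Mx0 : 0 < M * x by rewrite mulr_gt0.
have l1 : 0 <= 1 + lambda by rewrite addr_ge0// ltW.
have sV := nnsummableZ l1 (summable_frequent sp Mx0).
have sLx := nnsummableZ (ltW l0) (summable_capped sp x0).
have sLlx := summable_capped sp lx0.
have key j : `|lambda * Num.min (x * p j) 1 - Num.min (lambda * x * p j) 1|
    <= (1 + lambda) * (1 / (M * x) <= p j)%R%:R.
  rewrite inv_le_mass// -!mulrA; set y := x * p j.
  have y0 : 0 <= y by rewrite mulr_ge0// ltW.
  have ly0 : 0 <= lambda * y by rewrite mulr_ge0// ltW.
  have m1 : 0 <= Num.min y 1 <= 1 by rewrite le_min y0 ler01 ge_min lexx orbT.
  have m2 : 0 <= Num.min (lambda * y) 1 <= 1.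
    by rewrite le_min ly0 ler01 ge_min lexx orbT.
  case: (leP 1 (M * y)) => [_|My1].
    rewrite mulr1 ler_norml.
    have : 0 <= lambda * Num.min y 1 <= lambda.
      by move: m1 => /andP[? ?]; rewrite ler_piMr ?(ltW l0)// mulr_ge0 ?(ltW l0).
    lra.
  have yM : y <= M * y by rewrite ler_peMl// le_max lexx.
  have lyM : lambda * y <= M * y by rewrite ler_wpM2r// le_max lexx orbT.
  by rewrite !min_l ?subrr ?normr0 ?mulr0//; apply: ltW; apply: le_lt_trans My1.
have : lambda * L x <= L (lambda * x) + (1 + lambda) * V (M * x).
  rewrite -!tsumZ//; [|exact: summable_frequent|exact: ltW|exact: summable_capped].
  rewrite -tsumD//; apply: le_tsum => //; first exact: nnsummableD.
  by move=> j /=; move: (key j); rewrite ler_norml; lra.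
have : L (lambda * x) <= lambda * L x + (1 + lambda) * V (M * x).
  rewrite -!tsumZ//; [|exact: summable_frequent|exact: ltW|exact: summable_capped].
  rewrite -tsumD//; apply: le_tsum => //; first exact: nnsummableD.
  by move=> j /=; move: (key j); rewrite ler_norml; lra.
by rewrite ler_norml; lra.
Qed.

Let near_scale (y : R) (Q : set R) : 0 < y ->
  (\forall x \near +oo, Q x) -> \forall x \near +oo, Q (y * x).
Proof.
move=> y0 Qoo; have : y * x @[x --> +oo] --> +oo by exact: gt0_cvgMry.
exact.
Qed.

(** After division by [V x], the halving inequality reads
    [L x / V x >= 1 / 2 + (V (2 * x) / V x) / 2 * (L (2 * x) / V (2 * x))]. Since
    [V (2 * x) / V x] tends to [2], each step of the induction could raise the
    lower bound by any number less than [1 / 2]; here it is [1 / 4]. *)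
Lemma capped_frequent_unbounded (K : nat) :
  \forall x \near +oo, K%:R / 4 <= L x / V x.
Proof.
elim: K => [|K IH].
  near=> x; have x0 : 0 <= x by near: x; exact: nbhs_pinfty_ge.
  rewrite mul0r divr_ge0 ?frequent_count_ge0//.
  by apply: tsum_ge0 => j; rewrite le_min ler01 andbT mulr_ge0.
have IH2 : \forall x \near +oo, K%:R / 4 <= L (2 * x) / V (2 * x).
  by apply: (near_scale _ IH).
have d0 : 2 - (K.+1%:R)^-1 < 2 `^ 1 :> R.
  by rewrite powRr1// gtrBl invr_gt0.
have V2 : \forall x \near +oo, 2 - (K.+1%:R)^-1 < V (2 * x) / V x.
  by apply: (cvgr_gt _ (Vrv (ltr0Sn R 1)) _ d0).
near=> x.
have x0 : 0 < x by near: x; exact: nbhs_pinfty_gt.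
have Vx0 : 0 < V x by near: x.
have V2x0 : 0 < V (2 * x) by near: x; exact: (near_scale _ Vpos).
have A : K%:R / 4 <= L (2 * x) / V (2 * x) by near: x.
have B : 2 - (K.+1%:R)^-1 < V (2 * x) / V x by near: x.
have : (2^-1 * V x + 2^-1 * L (2 * x)) / V x <= L x / V x.
  by rewrite ler_pM2r ?invr_gt0//; exact: capped_mass_halving.
apply: le_trans; rewrite mulrDl mulfK ?gt_eqF//.
have -> : 2^-1 * L (2 * x) / V x = 2^-1 * (L (2 * x) / V (2 * x) * (V (2 * x) / V x)).
  by field; rewrite !gt_eqF.
have C : K%:R / 4 * (2 - (K.+1%:R)^-1) <= L (2 * x) / V (2 * x) * (V (2 * x) / V x).
  apply: ler_pM => //; last exact: ltW.
  by rewrite subr_ge0 (@le_trans _ _ 1)// ?ler1n// invf_le1// ler1n.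
have D : K%:R / K.+1%:R <= 1 :> R by rewrite ler_pdivrMr// mul1r ler_nat.
rewrite -natr1.
have -> : (K%:R + 1) / 4 = 2^-1 + 2^-1 * (K%:R / 4 * 2 - 2^-1) :> R by lra.
move: C D; rewrite mulrBr [_ / 4 / _]mulrAC.
move: (K%:R / K.+1%:R) (L (2 * x) / _ * _) => r q; lra.
Unshelve. all: by end_near. Qed.

Lemma frequent_capped_cvg0 : V x / L x @[x --> +oo] --> 0.
Proof.
have LVoo : L x / V x @[x --> +oo] --> +oo.
  apply/cvgryPge => A.
  have := capped_frequent_unbounded (Num.bound (4 * A)).
  apply: filterS => x; apply: le_trans.
  rewrite ler_pdivlMr// mulrC.
  have [A0|A0] := leP 0 A; first by apply/ltW/archi_boundP; rewrite mulr_ge0.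
  by rewrite (@le_trans _ _ 0)// pmulr_rle0// ltW.
have LV0 : \forall x \near +oo, 0 < L x / V x by apply: (cvgryPgt _).1.
rewrite (_ : (fun x => V x / L x) = (fun x => (L x / V x)^-1)).
  by apply/gtr0_cvgV0.
by apply/funext => x; rewrite invf_div.
Qed.

Lemma capped_pos : \forall x \near +oo, 0 < L x.
Proof.
near=> x; apply: lt_le_trans (frequent_le_capped sp _); first by near: x.
by near: x; exact: nbhs_pinfty_gt.
Unshelve. all: by end_near. Qed.

(* for a given dilation, V (M x) is negligible before L x *)
Let frequent_dilation_cvg0 (M : R) : 0 < M -> V (M * x) / L x @[x --> +oo] --> 0.
Proof.
move=> M0.
have : V (M * x) / V x * (V x / L x) @[x --> +oo] --> M `^ 1 * 0.
  by apply: cvgM; [exact: Vrv|exact: frequent_capped_cvg0].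
rewrite mulr0; apply: cvg_trans; apply: near_eq_cvg.
near=> x; rewrite /= mulrA divfK// gt_eqF//; by near: x.
Unshelve. all: by end_near. Qed.

(** As [V] is negligible before [L], the error in [capped_mass_scaling] vanishes
    in the limit, where [L] behaves like a linear function. *)
Lemma capped_regularly_varying : regularly_varying 1 L.
Proof.
move=> l l0; rewrite powRr1 ?ltW//.
set M := Num.max 1 l.
have M0 : 0 < M by rewrite lt_max ltr01.
have h : (1 + l) * (V (M * x) / L x) @[x --> +oo] --> 0.
  by rewrite -(mulr0 (1 + l)); apply: cvgM;
    [exact: cvg_cst|exact: frequent_dilation_cvg0].
apply/cvgrPdist_le => e e0.
have he : \forall x \near +oo, (1 + l) * (V (M * x) / L x) <= e.
  by apply: (cvgr_le _ h _ e0).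
near=> x.
have x0 : 0 < x by near: x; exact: nbhs_pinfty_gt.
have L0 : 0 < L x by near: x; exact: capped_pos.
have -> : l - L (l * x) / L x = (l * L x - L (l * x)) / L x.
  by rewrite mulrBl mulfK// gt_eqF.
rewrite normrM normfV (gtr0_norm L0) (@le_trans _ _ ((1 + l) * (V (M * x) / L x)))//.
  by rewrite mulrA ler_pM2r ?invr_gt0// capped_mass_scaling.
by near: x.
Unshelve. all: by end_near. Qed.

Lemma occupancy_le_capped m : (0 < m)%N -> occupancy p m <= L m%:R.
Proof.
move=> m0; apply: le_tsum; [exact: summable_occupancy| |].
  by apply: summable_capped => //; rewrite ltr0n.
move=> j; rewrite le_min gerBl exprn_ge0 ?subr_ge0// andbT.
by rewrite lerBlDr -lerBlDl; exact: bernoulli_ineq.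
Qed.

(** At the indices with [m * p j < e] the term [1 - (1 - p j) ^+ m] is at least
    [(1 - e) * (m * p j)]; the others are counted by [V (e^-1 * m)]. *)
Lemma occupancy_ge_capped m (e : R) : (0 < m)%N -> 0 < e -> e <= 1 ->
  (1 - e) * L m%:R <= occupancy p m + V (e^-1 * m%:R).
Proof.
move=> m0 e0 e1; have m0' : 0 < m%:R :> R by rewrite ltr0n.
have em0 : 0 < e^-1 * m%:R by rewrite mulr_gt0// invr_gt0.
have e1' : 0 <= 1 - e by rewrite subr_ge0.
have sL := summable_capped sp m0'; have sV := summable_frequent sp em0.
have so := summable_occupancy sp p_le1 m.
rewrite -tsumZ// -tsumD//; apply: le_tsum; [exact: nnsummableZ|exact: nnsummableD|].
move=> j /=; rewrite inv_le_mass// -mulrA ler_pdivlMl// mulr1.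
set y := m%:R * p j; have y0 : 0 <= y by rewrite mulr_ge0// ltW.
have t0 := occupancy_term_ge0 sp p_le1 m j.
have mn1 : Num.min y 1 <= 1 by rewrite ge_min lexx orbT.
case: (leP e y) => [_|ye] /=.
  have : (1 - e) * Num.min y 1 <= 1 - e by rewrite ler_piMr.
  lra.
rewrite addr0 min_l; last by rewrite (le_trans (ltW ye)).
have : (1 - p j) ^+ m <= expR (- y).
  rewrite -mulrN expRM_natl lerXn2r ?nnegrE ?expR_ge0 ?subr_ge0//.
  exact: expR_ge1Dx.
have a1 := expR_ge1Dx y; have a2 := expR_ge1Dx (- y).
have a3 : expR (- y) * expR y = 1 by rewrite -expRD addNr expR0.
have : expR (- y) * (1 + y) <= 1 by rewrite -[leRHS]a3 ler_wpM2l ?expR_ge0.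
have : y * (1 - e) <= y * (expR (- y)) by rewrite ler_wpM2l//; lra.
lra.
Qed.

Lemma occupancy_capped_asymp : occupancy p m / L m%:R @[m --> \oo] --> (1 : R).
Proof.
apply/cvgrPdist_le => e' e'0.
pose e := Num.min (e' / 2) 1.
have e0 : 0 < e by rewrite lt_min ltr01 divr_gt0.
have e1 : e <= 1 by rewrite ge_min lexx orbT.
have ee' : e <= e' / 2 by rewrite ge_min lexx.
have ei0 : 0 < e^-1 by rewrite invr_gt0.
have nat_oo : (n%:R : R) @[n --> \oo] --> +oo by exact: cvgr_idn.
have h : V (e^-1 * m%:R) / L m%:R @[m --> \oo] --> 0.
  apply: (cvg_comp (fun n => n%:R) (fun x => V (e^-1 * x) / L x) nat_oo).
  exact: frequent_dilation_cvg0.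
have he : \forall m \near \oo, V (e^-1 * m%:R) / L m%:R <= e.
  by apply: (cvgr_le _ h _ e0).
have Lpos : \forall m \near \oo, 0 < L m%:R by exact: (nat_oo _ capped_pos).
near=> m.
have m0 : (0 < m)%N by near: m; exact: nbhs_infty_gt.
have L0 : 0 < L m%:R by near: m.
have hm : V (e^-1 * m%:R) / L m%:R <= e by near: m.
have up := occupancy_le_capped m0.
have lo := occupancy_ge_capped m0 e0 e1.
move: hm; rewrite ler_pdivrMr// => hm.
have ub : occupancy p m / L m%:R <= 1 by rewrite ler_pdivrMr// mul1r.
have lb : 1 - 2 * e <= occupancy p m / L m%:R by rewrite ler_pdivlMr//; lra.
by rewrite ler_norml; lra.
Unshelve. all: by end_near. Qed.

End KarlinOne.

(** * A strong law for counts of occurrences *)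

Section SquareSubsequence.
Variable R : realType.

(** [n_ k] is the first index at which [mu] reaches [k ^+ 2]. As [mu] grows by at
    most [1] at each step, [mu (n_ k) <= k ^+ 2 + 1], so the values of [mu] at
    consecutive thresholds have a ratio tending to [1], and the monotone sequence
    [D] cannot deviate from [mu] in between. *)
Lemma square_subsequence (mu : nat -> R) :
  mu 0 = 0 -> (forall m, mu m <= mu m.+1 <= mu m + 1) -> mu @ \oo --> +oo ->
  exists2 n_ : nat -> nat, (forall k, k%:R ^+ 2 <= mu (n_ k)) &
    forall D : nat -> R, (forall m, 0 <= D m) -> (forall m, D m <= D m.+1) ->
      D (n_ k.+1) / mu (n_ k.+1) @[k --> \oo] --> (1 : R) ->
      D m / mu m @[m --> \oo] --> (1 : R).
Proof.
move=> mu00 muS muoo.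
have mono : {homo mu : m n / (m <= n)%N >-> m <= n}.
  by apply/nondecreasing_seqP => m; have /andP[] := muS m.
have mu0 m : 0 <= mu m by rewrite -mu00 mono.
have muge (A : R) : \forall m \near \oo, A <= mu m by apply: (cvgryPge _).1.
have exn k : exists m, k%:R ^+ 2 <= mu m.
  by have [N _ /(_ N (leqnn N)) Nk] := muge (k%:R ^+ 2); exists N.
pose n_ k := ex_minn (exn k); exists n_ => [k|].
  by rewrite /n_; case: ex_minnP.
have nge k : k%:R ^+ 2 <= mu (n_ k) by rewrite /n_; case: ex_minnP.
have nmin k m : k%:R ^+ 2 <= mu m -> (n_ k <= m)%N.
  by rewrite /n_; case: ex_minnP => n _; apply.
have nle k : mu (n_ k) <= k%:R ^+ 2 + 1.
  case E : (n_ k) => [|n]; first by rewrite mu00 addr_ge0// sqr_ge0.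
  have /andP[_ /le_trans] := muS n; apply; rewrite lerD2r leNgt.
  by apply/negP => /ltW /nmin; rewrite E ltnn.
move=> D D0 DS DT.
have Dmono : {homo D : m n / (m <= n)%N >-> m <= n} by exact/nondecreasing_seqP.
pose T k := D (n_ k.+1) / mu (n_ k.+1).
have cvg_sqr (u : nat -> R) (l : R) : u @ \oo --> l -> u k ^+ 2 @[k --> \oo] --> l ^+ 2.
  by move=> ul; under eq_fun do rewrite expr2; rewrite expr2; exact: cvgM.
have hoo : (k.+1%:R^-1 : R) @[k --> \oo] --> 0 by exact: cvg_harmonic.
have hoo2 : (k.+2%:R^-1 : R) @[k --> \oo] --> 0.
  by move: hoo; rewrite -cvg_shiftS.
pose s k : R := (1 - k.+2%:R^-1) ^+ 2.
have s1 : s k @[k --> \oo] --> (1 : R).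
  have -> : (1 : R) = (1 - 0) ^+ 2 by rewrite subr0 expr1n.
  by apply: cvg_sqr; apply: cvgB => //; exact: cvg_cst.
pose r k : R := (1 + k.+1%:R^-1) ^+ 2 + k.+1%:R^-1 ^+ 2.
have r1 : r k @[k --> \oo] --> (1 : R).
  have -> : (1 : R) = (1 + 0) ^+ 2 + 0 ^+ 2 by rewrite addr0 expr1n expr0n addr0.
  apply: cvgD; last exact: cvg_sqr.
  by apply: cvg_sqr; apply: cvgD => //; exact: cvg_cst.
(* Chosen so that [n_ (kap m).+1 <= m < n_ (kap m).+2]. *)
pose kap m := (Num.truncn (Num.sqrt (mu m))).-1.
have mukap m : 1 <= mu m -> (kap m).+1%:R ^+ 2 <= mu m < (kap m).+2%:R ^+ 2.
  move=> m1; have sq := truncn_itv (sqrtr_ge0 (mu m)).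
  have sq1 : 1 <= Num.sqrt (mu m) by rewrite -sqrtr1 ler_wsqrtr.
  have kE : (kap m).+1 = Num.truncn (Num.sqrt (mu m)).
    by rewrite /kap prednK// truncn_gt0.
  rewrite kE; move: sq => /andP[a b].
  rewrite -[X in _ <= X < _](sqr_sqrtr (mu0 m)).
  by rewrite lerXn2r ?nnegrE ?sqrtr_ge0//= ltrXn2r// ?nnegrE ?sqrtr_ge0.
have kapoo : kap m @[m --> \oo] --> \oo.
  apply/cvgnyPge => A.
  apply: filterS (muge (A.+1%:R ^+ 2)) => m Am.
  have m1 : 1 <= mu m by rewrite (le_trans _ Am)// exprn_ege1// ler1n.
  have /andP[_ h] := mukap m m1.
  have : A.+1%:R ^+ 2 < (kap m).+2%:R ^+ 2 :> R by apply: le_lt_trans h.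
  by rewrite ltr_pXn2r ?nnegrE// ltr_nat !ltnS.
have lo : T (kap m) * s (kap m) @[m --> \oo] --> (1 : R).
  rewrite -[X in _ --> X]mulr1.
  by apply: (cvg_comp kap (fun k => T k * s k) kapoo); exact: cvgM.
have hi : T (kap m).+1 * r (kap m) @[m --> \oo] --> (1 : R).
  rewrite -[X in _ --> X]mulr1.
  apply: (cvg_comp kap (fun k => T k.+1 * r k) kapoo); apply: cvgM => //.
  by move: DT; rewrite -cvg_shiftS.
apply: squeeze_cvgr lo hi.
near=> m; have m1 : 1 <= mu m by near: m; exact: muge.
have mupos : 0 < mu m by exact: lt_le_trans m1.
have /andP[k1 k2] := mukap m m1; set k := kap m in k1 k2 *.
have c1 : 0 < k.+1%:R :> R by []. have c2 : 0 < k.+2%:R :> R by [].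
have nk0 j : 0 < mu (n_ j.+1) by apply: lt_le_trans (nge _); rewrite exprn_gt0.
have sq0 j : 0 < j.+1%:R ^+ 2 :> R by rewrite exprn_gt0.
have sE : s k = k.+1%:R ^+ 2 / k.+2%:R ^+ 2.
  rewrite /s -expr_div_n; congr (_ ^+ _); apply: (mulIf (lt0r_neq0 c2)).
  by rewrite mulrBl mul1r mulVf ?divfK ?lt0r_neq0// -natr1 addrK.
have rE : r k = (k.+2%:R ^+ 2 + 1) / k.+1%:R ^+ 2.
  rewrite /r mulrDl -expr_div_n exprVn mul1r; congr (_ ^+ _ + _).
  apply: (mulIf (lt0r_neq0 c1)).
  by rewrite mulrDl mul1r mulVf ?divfK ?lt0r_neq0// natr1.
have unT j : D (n_ j.+1) = T j * mu (n_ j.+1) by rewrite /T divfK// gt_eqF.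
have T0 j : 0 <= T j by rewrite divr_ge0// ltW.
apply/andP; split.
  have Dm : D (n_ k.+1) <= D m by apply: Dmono; exact: nmin.
  apply: (@le_trans _ _ (D (n_ k.+1) / mu m)); last by rewrite ler_pM2r ?invr_gt0.
  rewrite unT -mulrA ler_wpM2l// sE ler_pM ?invr_ge0 ?(ltW (sq0 _))//.
  by rewrite lef_pV2 ?posrE// ltW.
have Dm : D m <= D (n_ k.+2).
  apply: Dmono; rewrite leqNgt; apply/negP => /ltnW /mono.
  by rewrite leNgt (lt_le_trans k2 (nge _)).
apply: (@le_trans _ _ (D (n_ k.+2) / mu m)); first by rewrite ler_pM2r ?invr_gt0.
rewrite unT -mulrA ler_wpM2l// rE ler_pM ?(ltW (nk0 _)) ?invr_ge0 ?(ltW mupos)//.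
by rewrite lef_pV2 ?posrE.
Unshelve. all: by end_near. Qed.
End SquareSubsequence.

Section StrongLaw.
Context {d : measure_display} {Omega : measurableType d} {R : realType}.
Variable P : probability Omega R.

Lemma measurable_occurrence_count (E : nat -> set Omega) (D : Omega -> R) :
  (forall j, measurable (E j)) ->
  (forall w, (D w)%:E = \sum_(j <oo) (\1_(E j) w : R)%:E)%E ->
  measurable_fun [set: Omega] D.
Proof.
move=> mE DE; apply/measurable_EFinP.
rewrite (_ : _ \o _ = fun w => \sum_(j <oo) (\1_(E j) w : R)%:E)%E; last exact/funext.
apply: (@ge0_emeasurable_sum _ _ _ _ _ xpredT) => [k w _ _|k _]; first by rewrite lee_fin.
by apply/measurable_EFinP; exact: measurable_indic.
Qed.

(** The second moment of [D] is the sum over [j] and [k] of the probabilities of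
    [E j `&` E k]. The terms with [j != k] sum to at most the square of the mean,
    and those with [j = k] to the mean. *)
Lemma variance_le_mean (E : nat -> set Omega) (p : nat -> R) (D : Omega -> R) :
  (forall j, measurable (E j)) -> (forall j, P (E j) = (p j)%:E) -> nnsummable p ->
  (forall w, (D w)%:E = \sum_(j <oo) (\1_(E j) w : R)%:E)%E ->
  (forall j k, j != k -> (P (E j `&` E k) <= (p j * p k)%:E)%E) ->
  (\int[P]_w ((D w - tsum p) ^+ 2)%:E <= (tsum p)%:E)%E.
Proof.
move=> mE PE sp DE corr; set mu := tsum p.
have mu0 : 0 <= mu by apply: tsum_ge0; exact: sp.1.
have i0 j w : (0 <= (\1_(E j) w : R)%:E)%E by rewrite lee_fin.
have mi j : measurable_fun [set: Omega] (fun w => (\1_(E j) w : R)%:E).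
  by apply/measurable_EFinP; exact: measurable_indic.
have mD := measurable_occurrence_count mE DE.
have D0 w : 0 <= D w by rewrite -lee_fin DE; exact: nneseries_ge0.
have mDi j : measurable_fun [set: Omega] (fun w => (D w * \1_(E j) w)%:E).
  by apply/measurable_EFinP; apply: measurable_funM => //; exact: measurable_indic.
have intD : (\int[P]_w (D w)%:E = mu%:E)%E.
  under eq_integral do rewrite DE.
  rewrite integral_nneseries// tsumE//; apply: eq_eseriesr => j _.
  by rewrite integral_indic// setIT -PE.
have D2E w : ((D w ^+ 2)%:E = \sum_(j <oo) (D w * \1_(E j) w)%:E)%E.
  under eq_eseriesr do rewrite EFinM.
  by rewrite nneseriesZl// -DE.
have intDi j : (\int[P]_w (D w * \1_(E j) w)%:E <= (p j * mu + p j)%:E)%E.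
  have DiE w : ((D w * \1_(E j) w)%:E = \sum_(k <oo) (\1_(E j `&` E k) w : R)%:E)%E.
    rewrite mulrC EFinM DE -nneseriesZl//; apply: eq_eseriesr => k _.
    by rewrite indicI.
  under eq_integral do rewrite DiE.
  rewrite integral_nneseries//; last first.
    by move=> k; apply/measurable_EFinP; apply: measurable_indic; exact: measurableI.
  (* The last summand accounts for the diagonal term [k = j]. *)
  apply: (@le_trans _ _ (\sum_(k <oo) ((p j * p k)%:E + (p j * (k \in [:: j])%:R)%:E))%E).
    apply: lee_nneseries => k; first by move=> _; rewrite integral_ge0.
    rewrite integral_indic ?setIT//; last exact: measurableI.
    rewrite inE => _; have [->|kj] := eqVneq k j.
      have pj0 := sp.1 j; rewrite mulr1 setIid.
      rewrite -EFinD; apply: (@le_trans _ _ (p j)%:E).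
        by rewrite -PE.
      by rewrite lee_fin lerDr mulr_ge0.
    by rewrite mulr0 adde0 corr// eq_sym.
  rewrite nneseriesD//; [|by move=> k _ _; rewrite lee_fin mulr_ge0 ?sp.1..].
  under eq_eseriesr do rewrite EFinM.
  under [X in (_ + X <= _)%E]eq_eseriesr do rewrite EFinM.
  rewrite !nneseriesZl; [|by move=> k _; rewrite lee_fin ?sp.1..].
  by rewrite nneseries_mem_uniq// -tsumE// mule1 -EFinM -EFinD.
have intD2 : (\int[P]_w (D w ^+ 2)%:E <= (mu ^+ 2 + mu)%:E)%E.
  under eq_integral do rewrite D2E.
  rewrite integral_nneseries//; last by move=> j w _; rewrite lee_fin mulr_ge0.
  apply: (@le_trans _ _ (\sum_(j <oo) (mu * p j + p j)%:E)%E).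
    apply: lee_nneseries => j; last by rewrite [mu * _]mulrC.
    by move=> _; rewrite integral_ge0// => w _; rewrite lee_fin mulr_ge0.
  have s1 := nnsummableZ mu0 sp.
  by rewrite -(tsumE (nnsummableD s1 sp)) (tsumD s1 sp) (tsumZ mu0 sp) expr2.
have m2 : measurable_fun [set: Omega] (fun w => ((D w - mu) ^+ 2)%:E).
  by apply/measurable_EFinP; apply: measurable_funX; exact: measurable_funB.
(* The square is expanded with all terms on the side where they are
   nonnegative, so that the integrals are additive without integrability. *)
have key : (\int[P]_w ((D w - mu) ^+ 2)%:E + (2 * mu * mu)%:E =
    \int[P]_w (D w ^+ 2)%:E + (mu ^+ 2)%:E)%E.
  have -> : ((2 * mu * mu)%:E = \int[P]_w ((2 * mu) * D w)%:E)%E.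
    under eq_integral do rewrite EFinM.
    rewrite ge0_integralZl_EFin ?intD ?mulr_ge0//; first by move=> w _; rewrite lee_fin.
    exact/measurable_EFinP.
  have -> : ((mu ^+ 2)%:E = \int[P]_w (mu ^+ 2)%:E)%E.
    by rewrite (integral_cst P _ (mu ^+ 2)%:E)// -[LHS]mule1 -(probability_setT P).
  rewrite -!ge0_integralD//.
  - by apply: eq_integral => w _; rewrite -!EFinD; congr EFin; ring.
  - by move=> w _; rewrite lee_fin sqr_ge0.
  - by apply/measurable_EFinP; exact: measurable_funX.
  - by move=> w _; rewrite lee_fin sqr_ge0.
  - by move=> w _; rewrite lee_fin sqr_ge0.
  - by move=> w _; rewrite lee_fin !mulr_ge0.
  - by apply/measurable_EFinP; exact: measurable_funM.
rewrite -(@leeD2rE _ (2 * mu * mu)%:E)// key.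
apply: (@le_trans _ _ ((mu ^+ 2 + mu)%:E + (mu ^+ 2)%:E)%E); first exact: leeD2r.
by rewrite -!EFinD lee_fin; lra.
Qed.

(** The expectation of the [k]-th term of the series of
    [(D (n_ k.+1) / mu (n_ k.+1) - 1) ^+ 2] is at most [1 / mu (n_ k.+1)], hence at
    most [1 / k.+1 ^+ 2]. So the series converges almost surely, and its terms
    tend to zero. *)
Lemma strong_law_of_variance (D : nat -> Omega -> R) (mu : nat -> R) :
  (forall m, measurable_fun [set: Omega] (D m)) ->
  (forall m w, 0 <= D m w) -> (forall m w, D m w <= D m.+1 w) ->
  (forall m, (\int[P]_w ((D m w - mu m) ^+ 2)%:E <= (mu m)%:E)%E) ->
  mu 0 = 0 -> (forall m, mu m <= mu m.+1 <= mu m + 1) -> mu @ \oo --> +oo ->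
  {ae P, forall w, D m w / mu m @[m --> \oo] --> (1 : R)}.
Proof.
move=> mD D0 DS var mu0 muS muoo.
have [n_ nge Dcvg] := square_subsequence mu0 muS muoo.
pose T k w := D (n_ k.+1) w / mu (n_ k.+1).
have mupos k : 0 < mu (n_ k.+1) by apply: lt_le_trans (nge _); rewrite exprn_gt0.
have mT k : measurable_fun [set: Omega] (fun w => ((T k w - 1) ^+ 2)%:E).
  apply/measurable_EFinP; apply: measurable_funX; apply: measurable_funB => //.
  exact: measurable_funM.
have T0 k w : (0 <= ((T k w - 1) ^+ 2)%:E)%E by rewrite lee_fin sqr_ge0.
have intT k : (\int[P]_w ((T k w - 1) ^+ 2)%:E <= ((k.+1%:R ^+ 2)^-1)%:E)%E.
  have TE w : (((T k w - 1) ^+ 2)%:E =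
      ((mu (n_ k.+1)) ^- 2)%:E * ((D (n_ k.+1) w - mu (n_ k.+1)) ^+ 2)%:E)%E.
    rewrite -EFinM; congr EFin; rewrite /T -exprVn -exprMn; congr (_ ^+ _).
    by rewrite mulrBr mulVf ?lt0r_neq0// mulrC.
  under eq_integral do rewrite TE.
  rewrite ge0_integralZl_EFin//.
  - apply: (@le_trans _ _ ((mu (n_ k.+1) ^- 2)%:E * (mu (n_ k.+1))%:E)%E).
      by rewrite lee_wpmul2l// lee_fin invr_ge0 sqr_ge0.
    rewrite -EFinM lee_fin expr2 invfM -mulrA mulVf ?lt0r_neq0// mulr1.
    by rewrite lef_pV2 ?posrE ?exprn_gt0.
  - by move=> w _; rewrite lee_fin sqr_ge0.
  - apply/measurable_EFinP; apply: measurable_funX; exact: measurable_funB.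
  - by rewrite invr_ge0 sqr_ge0.
have mS : measurable_fun [set: Omega] (fun w => \sum_(k <oo) ((T k w - 1) ^+ 2)%:E)%E.
  exact: (@ge0_emeasurable_sum _ _ _ _ _ xpredT).
have iS : P.-integrable [set: Omega] (fun w => \sum_(k <oo) ((T k w - 1) ^+ 2)%:E)%E.
  apply/integrableP; split => //.
  under eq_integral do rewrite gee0_abs ?nneseries_ge0//.
  rewrite integral_nneseries//.
  have [_] := inv_sqr_summable R; apply: le_lt_trans.
  by apply: lee_nneseries => k //; rewrite integral_ge0.
apply: filterS (integrable_ae measurableT iS) => w /(_ I) fin.
apply: Dcvg => // ; rewrite -/(T _ w).
have : nnsummable (fun k => (T k w - 1) ^+ 2).
  by split=> [k|]; rewrite ?sqr_ge0// -ge0_fin_numE// nneseries_ge0.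
move=> /nnsummable_cvg0/cvgrPdist_lt c0.
apply/cvgrPdist_lt => e e0.
have e20 : 0 < e ^+ 2 by rewrite exprn_gt0.
apply: filterS (c0 _ e20) => k; rewrite sub0r normrN ger0_norm ?sqr_ge0//.
rewrite -real_normK ?num_real// distrC ltr_pXn2r ?nnegrE//; exact: ltW.
Qed.

Lemma occurrence_strong_law (E : nat -> nat -> set Omega) (p : nat -> nat -> R)
    (D : nat -> Omega -> R) :
  (forall m j, measurable (E m j)) -> (forall m j, P (E m j) = (p m j)%:E) ->
  (forall m, nnsummable (p m)) ->
  (forall m w, (D m w)%:E = \sum_(j <oo) (\1_(E m j) w : R)%:E)%E ->
  (forall m j k, j != k -> (P (E m j `&` E m k) <= (p m j * p m k)%:E)%E) ->
  (forall m w, D m w <= D m.+1 w) -> tsum (p 0) = 0 ->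
  (forall m, tsum (p m) <= tsum (p m.+1) <= tsum (p m) + 1) ->
  tsum (p m) @[m --> \oo] --> +oo ->
  {ae P, forall w, D m w / tsum (p m) @[m --> \oo] --> (1 : R)}.
Proof.
move=> mE PE sp DE corr DS p0 pS poo.
apply: (@strong_law_of_variance D (fun m => tsum (p m))) => // m.
- exact: measurable_occurrence_count (mE m) (DE m).
- move=> w; rewrite -lee_fin DE; apply: nneseries_ge0 => j _ _.
  by rewrite lee_fin.
- exact: variance_le_mean (mE m) (PE m) (sp m) (DE m) (corr m).
Qed.

End StrongLaw.

(** * Blocks of the induced partition *)

Section BlockGrowth.
Local Open Scope nat_scope.

Lemma card_induced_partition (X : eqType) (xi : nat -> X) n :
  #|induced_partition xi n| = size (undup [seq xi i | i <- iota 0 n]).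
Proof.
pose s := [seq xi i | i <- iota 0 n].
pose G v := [set y : 'I_n | v == xi y]%SET.
have sP v : reflect (exists y : 'I_n, v = xi y) (v \in undup s).
  rewrite mem_undup; apply: (iffP mapP) => [[i]|[y ->]].
    by rewrite mem_iota => /andP[_ ilt] ->; exists (Ordinal ilt).
  by exists (val y) => //; rewrite mem_iota ltn_ord.
have Ginj : {in undup s &, injective G}.
  move=> v v' /sP[y ->] _ /finset.setP /(_ y); rewrite !inE eqxx => /esym/eqP.
  by move=> ->.
rewrite -(size_map G) -(card_uniqP _); last by rewrite map_inj_in_uniq ?undup_uniq.
apply: eq_card => A; apply/imsetP/mapP => [[x _ ->]|[v /sP[y ->] ->]].
  exists (xi x); first by apply/sP; exists x.
  by apply/finset.setP => y; rewrite !inE.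
by exists y => //; apply/finset.setP => z; rewrite !inE.
Qed.

Lemma least_le n (A : {set 'I_n}) (x : 'I_n) : x \in A -> least A <= x.
Proof.
move=> xA; rewrite leqNgt; apply/negP => /(before_find x).
by rewrite nth_ord_enum xA.
Qed.

Lemma least_mem n (A : {set 'I_n.+1}) : A != finset.set0 ->
  least A < n.+1 /\ inord (least A) \in A.
Proof.
move=> /set0Pn[x xA].
have hasA : has (fun i => i \in A) (enum 'I_n.+1).
  by apply/hasP; exists x; rewrite ?mem_enum.
have lt : least A < n.+1 by rewrite -[ltnRHS](size_enum_ord n.+1) -has_find.
split=> //; have := nth_find ord0 hasA.
rewrite -/(least A) (_ : nth _ _ _ = inord (least A))//.
by apply/val_inj; rewrite /= nth_enum_ord// inordK.
Qed.

Variables (pi : forall n, {set {set 'I_n}}).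
Hypothesis part_pi : forall n, finset.partition (pi n) [set: 'I_n]%SET.
Hypothesis restrict_pi : forall m n (mn : (m <= n)),
  restrict_partition mn (pi n) = pi m.

Let last_block n := finset.pblock (pi n.+1) ord_max.

Let coverT n (x : 'I_n) : x \in finset.cover (pi n).
Proof. by rewrite (finset.cover_partition (part_pi n)) inE. Qed.

Let triv n : finset.trivIset (pi n).
Proof. by have /and3P[] := part_pi n. Qed.

Let no_empty n A : A \in pi n -> A != finset.set0.
Proof.
have /and3P[_ _ n0] := part_pi n.
by apply: contraTneq => ->.
Qed.

Lemma size_ordered_blocks n : size (ordered_blocks (pi n)) = #|pi n|.
Proof. by rewrite size_sort cardE. Qed.

Lemma last_block_lt n : index (last_block n) (ordered_blocks (pi n.+1)) < #|pi n.+1|.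
Proof.
rewrite -size_ordered_blocks index_mem mem_sort mem_enum.
by apply: finset.pblock_mem; exact: coverT.
Qed.

Lemma card_pi0 : #|pi 0| = 0.
Proof.
apply: eq_card0 => A; apply/negP => /no_empty /set0Pn[[]].
by [].
Qed.

Let ord_maxP n (x : 'I_n.+1) :
  x = ord_max \/ exists y : 'I_n, x = widen_ord (leqnSn n) y.
Proof.
have := ltn_ord x; rewrite ltnS leq_eqVlt => /orP[/eqP xn|xn].
  by left; apply: val_inj.
by right; exists (Ordinal xn); apply: val_inj.
Qed.

Let single_or_restricted n A : A \in pi n.+1 ->
  A = [set ord_max]%SET \/ exists y : 'I_n, widen_ord (leqnSn n) y \in A.
Proof.
move=> Api.
have [/existsP[y yA]|] := boolP [exists y : 'I_n, widen_ord (leqnSn n) y \in A].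
  by right; exists y.
move=> /existsPn nA; left.
have nAm x : x \in A -> x = ord_max.
  by move=> xA; have [//|[y xy]] := ord_maxP x; move: (nA y); rewrite -xy xA.
have /set0Pn[x xA] := no_empty Api.
apply/finset.setP => z; rewrite !inE; apply/idP/eqP => [/nAm//|->].
by rewrite -(nAm x xA).
Qed.

Let rho n (A : {set 'I_n.+1}) : {set 'I_n} := (widen_ord (leqnSn n) @^-1: A)%SET.

Let rho_inj n : {in [set A in pi n.+1 | A != [set ord_max]]%SET &, injective (@rho n)}.
Proof.
move=> A B; rewrite !inE => /andP[Api An1] /andP[Bpi _] AB.
have [A1|[y yA]] := single_or_restricted Api; first by rewrite A1 eqxx in An1.
have yB : widen_ord (leqnSn n) y \in B.
  by move/finset.setP: AB => /(_ y); rewrite !inE yA => <-.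
by rewrite -(finset.def_pblock (triv _) Api yA) (finset.def_pblock (triv _) Bpi yB).
Qed.

Let pi_restrict n : pi n = (@rho n @: [set A in pi n.+1 | A != [set ord_max]])%SET.
Proof.
rewrite -(restrict_pi (leqnSn n)).
apply/finset.setP => B; rewrite !inE; apply/andP/imsetP.
  move=> [B0 /imsetP[A Api BA]]; exists A => //; rewrite inE Api.
  apply: contra_neq B0 => A1; rewrite BA A1; apply/finset.setP => y.
  rewrite !inE; apply/negbTE/negP => /eqP/(congr1 val)/= yn.
  by have := ltn_ord y; rewrite yn ltnn.
move=> [A]; rewrite inE => /andP[Api An1] ->; split; last by apply: imset_f.
have [A1|[y yA]] := single_or_restricted Api; first by rewrite A1 eqxx in An1.
by apply/set0Pn; exists y; rewrite inE.
Qed.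

Let card_pi n : #|pi n| = #|[set A in pi n.+1 | A != [set ord_max]]%SET|.
Proof. by rewrite pi_restrict card_in_imset//; exact: rho_inj. Qed.

Let single n : {set 'I_n.+1} := [set ord_max]%SET.

(** The restriction map is injective on the blocks other than the singleton of
    the new element, and the singleton is the only block that disappears. *)
Lemma card_piS n : #|pi n.+1| = (single n \in pi n.+1) + #|pi n|.
Proof.
rewrite (cardsD1 (single n) (pi n.+1)) (card_pi n); congr (_ + _).
by apply: eq_card => A; rewrite !inE andbC.
Qed.

(** A block made of the new element alone has the greatest least element, so it
    comes last in the ordered list. *)
Lemma new_block_index n : single n \in pi n.+1 ->
  index (last_block n) (ordered_blocks (pi n.+1)) = #|pi n|.
Proof.
move=> s1; have -> : last_block n = single n.
  by apply: finset.def_pblock => //; rewrite inE.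
set s := ordered_blocks _; set b := single n.
have bs : b \in s by rewrite mem_sort mem_enum.
have us : uniq s by rewrite sort_uniq enum_uniq.
have ss : sorted (fun A B => least A <= least B) s.
  by apply: sort_sorted => A B; exact: leq_total.
have sz : size s = #|pi n|.+1 by rewrite size_ordered_blocks card_piS s1.
have leastb : least b = n.
  have [lt] : least b < n.+1 /\ inord (least b) \in b.
    by apply: least_mem; apply/set0Pn; exists ord_max; rewrite inE.
  by rewrite inE => /eqP/(congr1 val)/=; rewrite inordK.
have ib : index b s < size s by rewrite index_mem.
apply/eqP; rewrite eqn_leq -ltnS -sz ib/= leqNgt; apply/negP => lt.
have lt' : (index b s).+1 < size s by rewrite sz.
pose C := nth b s (index b s).+1.
have Cpi : C \in pi n.+1.
  by have : C \in s by [exact: mem_nth]; rewrite mem_sort mem_enum.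
have Cb : C != b.
  apply/eqP => Cb; have := nth_uniq b lt' ib us; rewrite nth_index// -/C Cb eqxx.
  by move=> /esym/eqP/esym; exact: n_Sn.
have : least b <= least C.
  have := sorted_leq_nth _ _ b ss (index b s) (index b s).+1.
  rewrite nth_index//; apply=> //.
  by move=> ? ? ?; exact: leq_trans.
have [Cs|[y yC]] := single_or_restricted Cpi; first by rewrite Cs eqxx in Cb.
by rewrite leastb leqNgt (leq_ltn_trans (least_le yC))//=.
Qed.

Let idx i := index (last_block i) (ordered_blocks (pi i.+1)).

(** By induction: a new element either joins an existing block, whose index is
    below the number of blocks, or opens a block with the next index. *)
Lemma block_indices n : [seq idx i | i <- iota 0 n] =i iota 0 #|pi n|.
Proof.
elim: n => [|n IH] k; first by rewrite card_pi0.
rewrite -[n.+1]addn1 iotaD map_cat mem_cat IH addn1 add0n /= inE !mem_iota !add0n /=.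
have := card_piS n; have [s1|s1] := boolP (single n \in pi n.+1) => /= ->.
  have idxn : idx n = #|pi n| by exact: new_block_index.
  by rewrite idxn add1n ltnS [RHS]leq_eqVlt orbC.
rewrite add0n; apply/orb_idr => /eqP ->.
by have := last_block_lt n; rewrite card_piS (negbTE s1) add0n.
Qed.

(** Both lists of values come from the same set of block indices, with different
    repetitions. *)
Lemma size_undup_block_indices (X : eqType) (Z : nat -> X) n :
  size (undup [seq Z (idx i) | i <- iota 0 n]) =
  size (undup [seq Z k | k <- iota 0 #|pi n|]).
Proof.
apply/perm_size/uniq_perm; rewrite ?undup_uniq// => v; rewrite !mem_undup.
rewrite (map_comp Z idx); apply: eq_mem_map; exact: block_indices.
Qed.

End BlockGrowth.

(** * Borel structure of a Polish space *)

Section Separation.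
Context {R : realType} {X : ptopologicalType}.

(** The balls of radius [1 / n.+1] around the points of a countable dense set
    separate points. *)
Lemma polish_separating : polish R X ->
  exists2 U : nat * nat -> set X, (forall i, open (U i)) &
    forall x y, x != y -> exists i, U i x /\ ~ U i y.
Proof.
move=> [dist [[d0 dE dC dT] dN _ [D [/countable_injP[f injf] dD]]]].
pose g n := xget point [set s | D s /\ f s = n].
have gf s : D s -> g (f s) = s.
  move=> Ds; rewrite /g; case: xgetP => [t _ [Dt ft]|/(_ s)[]//].
  by apply: injf => //; rewrite inE.
pose U (i : nat * nat) : set X := [set x | dist (g i.1) x < i.2.+1%:R^-1].
have dxx x : dist x x = 0 by apply/dE.
have oball s (r : R) : open [set x | dist s x < r].
  rewrite openE => x /= sx; apply/dN.
  exists (r - dist s x); rewrite ?subr_gt0// => y /= xy.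
  by rewrite (le_lt_trans (dT _ x _))// -ltrBDl.
exists U => [i|x y xy]; first exact: oball.
have dxy : 0 < dist x y.
  by rewrite lt_def d0 andbT; apply: contra_neq xy => /dE.
pose n := Num.bound (2 / dist x y).
have nP : n.+1%:R^-1 < dist x y / 2.
  rewrite -[ltRHS]invf_div ltf_pV2 ?posrE ?divr_gt0//.
  by rewrite (lt_le_trans (archi_boundP _)) ?ler_nat// divr_ge0.
have [s [/= xs Ds]] : [set z | dist x z < n.+1%:R^-1] `&` D !=set0.
  by apply: dD; [exists x; rewrite /= dxx|exact: oball].
exists (f s, n); rewrite /U /= gf// dC; split=> //; rewrite dC => ys.
have := dT x s y; rewrite (dC s y); move: nP xs ys; move: (_^-1) => r; lra.
Qed.

End Separation.

Section BorelPolish.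
Context {R : realType} {X : ptopologicalType}.
Hypothesis polishX : polish R X.

Lemma open_measurable_borel (U : set X) : open U -> measurable (U : set (borel X)).
Proof. exact: sub_sigma_algebra. Qed.

(** The complement of the diagonal is the union over [i] of the rectangles
    [U i `*` ~` U i], for a separating sequence [U] of open sets. *)
Lemma measurable_diagonal :
  measurable [set xy : borel X * borel X | xy.1 = xy.2].
Proof.
have [U oU Usep] := polish_separating polishX.
rewrite -[X in measurable X]setCK; apply: measurableC.
have -> : ~` [set xy : borel X * borel X | xy.1 = xy.2] =
    \bigcup_i ((U i : set (borel X)) `*` ~` (U i : set (borel X))).
  apply/seteqP; split=> [[x y] /= /eqP/Usep[i [Ux nUy]]|[x y] [i _] [/= Ux nUy] xy].
    by exists i.
  by apply: nUy; rewrite -xy.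
apply: countable_bigcupT_measurable => // i.
by apply: measurableX; [|apply: measurableC]; exact: open_measurable_borel.
Qed.

Lemma measurable_singleton (y : borel X) : measurable [set y].
Proof.
have := measurable_xsection y measurable_diagonal.
congr (measurable _); apply/seteqP; split=> x; rewrite /xsection/= inE/=.
  by move=> ->.
by move=> ->.
Qed.

End BorelPolish.

(** * Independent samples *)

Lemma measurable_range_points {d : measure_display} {T : measurableType d}
    (f : nat -> T) : (forall j, measurable [set f j]) -> measurable (range f).
Proof.
move=> mf; rewrite (_ : range f = \bigcup_j [set f j]).
  exact: bigcupT_measurable.
by apply/seteqP; split=> x [j _]; [move=> <-|move=> ->]; exists j.
Qed.

Section Sampling.
Context {d d' : measure_display} {Omega : measurableType d} {T : measurableType d'}.
Context {R : realType}.
Variables (P : probability Omega R) (H : probability T R).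
Variable Z : nat -> {mfun Omega >-> T}.
Hypothesis iidZ : iid_with_law P H Z.

Lemma measurable_sample i (B : set T) : measurable B -> measurable (Z i @^-1` B).
Proof. by move=> mB; rewrite -[X in measurable X]setTI; exact: measurable_funP. Qed.

Lemma sample_law i (B : set T) : measurable B -> P (Z i @^-1` B) = H B.
Proof. by move=> mB; rewrite -(iidZ.1 i). Qed.

Lemma law_fineK (B : set T) : measurable B -> H B = (fine (H B))%:E.
Proof. by move=> mB; rewrite fineK// fin_num_measure. Qed.

Lemma sample_pair i k (A B : set T) : i != k -> measurable A -> measurable B ->
  P (Z i @^-1` A `&` Z k @^-1` B) = (H A * H B)%E.
Proof.
move=> ik mA mB.
pose C j := if j == i then A else B.
have mC j : measurable (C j) by rewrite /C; case: ifP.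
have := iidZ.2 [fset i; k]%fset C mC.
rewrite big_fsetU1 ?inE// big_seq_fset1 {2 3}/C eqxx eq_sym (negbTE ik) !sample_law//.
move=> <-; congr (P _); apply/seteqP; split=> [w [Aw Bw] j|w h].
  by rewrite /= !inE => /orP[]/eqP ->; rewrite /C ?eqxx// eq_sym (negbTE ik).
split.
  by have := h i; rewrite /= !inE eqxx /C eqxx; apply.
by have := h k; rewrite /= !inE eqxx orbT /C eq_sym (negbTE ik); apply.
Qed.

Lemma sample_all m (B : set T) : measurable B ->
  P (\bigcap_(i in `I_m) Z i @^-1` B) = (fine (H B) ^+ m)%:E.
Proof.
move=> mB; have := iidZ.2 (seq_fset tt (iota 0 m)) (fun=> B) (fun=> mB).
have -> : [set` seq_fset tt (iota 0 m)] = `I_m.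
  by apply/seteqP; split=> i; rewrite /mkset seq_fsetE mem_iota.
move=> ->.
under eq_bigr do rewrite sample_law// law_fineK//.
rewrite prodEFin; congr EFin.
rewrite big_const_seq count_predT iter_mulr_1.
by rewrite size_seq_fset undup_id ?iota_uniq// size_iota.
Qed.

(** By Fubini's theorem, the set of pairs of equal points with first coordinate in
    [A] has measure zero for the joint law of two samples, since each of its
    sections is empty or a point of mass zero. *)
Lemma samples_distinct (A : set T) : measurable A ->
  measurable [set xy : T * T | xy.1 = xy.2] ->
  (forall x, A x -> H [set x] = 0%E) ->
  {ae P, forall w i k, i != k -> A (Z i w) -> Z i w <> Z k w}.
Proof.
move=> mA mdiag HA.
suff pairwise i k : {ae P, forall w, i != k -> A (Z i w) -> Z i w <> Z k w}.
  by apply: ae_foralln => i; apply: ae_foralln => k; exact: pairwise.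
have [->|ik] := eqVneq i k; first exact: aeW.
pose E := [set xy : T * T | xy.1 = xy.2] `&` (A `*` setT).
have mE : measurable E by apply: measurableI => //; exact: measurableX.
have mZ : measurable_fun [set: Omega] (fun w => (Z i w, Z k w)).
  by apply: measurable_fun_pair; exact: measurable_funP.
have joint : (H \x H)%E E = distribution P (mfun_Sub (mem_set mZ)) E.
  apply: product_measure_unique => // B C mB mC.
  rewrite -(sample_pair ik mB mC) /distribution /pushforward /=.
  by congr (P _).
have : (H \x H)%E E = 0%E.
  rewrite /product_measure1/=; apply: integral0_eq => x _ /=.
  have [Ax|nAx] := pselect (A x).
    rewrite (_ : xsection E x = [set x]) ?HA//.
    apply/seteqP; split=> y; rewrite /xsection/= inE /E/=; first by move=> [->].
    by move=> ->.
  rewrite (_ : xsection E x = set0) ?measure0//.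
  by rewrite -subset0 => y; rewrite /xsection/= inE => -[_ []].
rewrite joint /distribution /pushforward /= => PE0.
exists ((fun w => (Z i w, Z k w)) @^-1` E); split=> //.
  by have := mZ measurableT _ mE; rewrite setTI.
move=> w /= nw; apply: contrapT => nE; apply: nw => _ Aw ZZ; exact: nE.
Qed.

(** The strong law of large numbers for the visits to [B], as the case of
    [occurrence_strong_law] where the events are independent. *)
Lemma sample_frequency (B : set T) : measurable B -> 0 < fine (H B) ->
  {ae P, forall w,
    (count (fun z => z \in B) [seq Z i w | i <- iota 0 m])%:R / m%:R
      @[m --> \oo] --> fine (H B)}.
Proof.
move=> mB h0; set h := fine (H B) in h0 *.
pose s m w := [seq i <- iota 0 m | Z i w \in B].
pose D m w : R := (size (s m w))%:R.
have us m w : uniq (s m w) by rewrite filter_uniq ?iota_uniq.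
have Dcount m w : D m w = (count (fun z => z \in B) [seq Z i w | i <- iota 0 m])%:R.
  by rewrite /D size_filter count_map.
pose E m i := if (i < m)%N then Z i @^-1` B else set0.
pose p m i := h * (i \in iota 0 m)%:R.
have Es m i w : \1_(E m i) w = (i \in s m w)%:R :> R.
  rewrite indicE mem_filter mem_iota /= add0n /E; case: ifP => im.
    by rewrite andbT; congr (nat_of_bool _)%:R; apply/idP/idP; rewrite !inE.
  by rewrite in_set0 andbF.
have mE m i : measurable (E m i).
  by rewrite /E; case: ifP => // _; exact: measurable_sample.
have PE m i : P (E m i) = (p m i)%:E.
  rewrite /E /p mem_iota add0n /=; case: ifP => im; last by rewrite measure0 mulr0.
  by rewrite mulr1 sample_law// law_fineK.
have sp m : nnsummable (p m).
  by apply: nnsummableZ; [exact: ltW|exact/nnsummable_mem/iota_uniq].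
have tp m : tsum (p m) = h * m%:R.
  rewrite tsumZ ?ltW ?tsum_mem_uniq ?size_iota ?iota_uniq//.
  exact/nnsummable_mem/iota_uniq.
have DE m w : ((D m w)%:E = \sum_(j <oo) (\1_(E m j) w : R)%:E)%E.
  by under eq_eseriesr do rewrite Es; rewrite nneseries_mem_uniq.
have corr m j k : j != k -> (P (E m j `&` E m k) <= (p m j * p m k)%:E)%E.
  move=> jk; rewrite /E /p !mem_iota !add0n /=.
  case: ifP => jm; last by rewrite set0I measure0 !mulr0 mul0r.
  case: ifP => km; last by rewrite setI0 measure0 !mulr0.
  by rewrite !mulr1 sample_pair// EFinM -law_fineK.
have : {ae P, forall w, D m w / tsum (p m) @[m --> \oo] --> (1 : R)}.
  apply: (occurrence_strong_law mE PE sp DE corr).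
  - by move=> m w; rewrite ler_nat /s !size_filter -[m.+1]addn1 iotaD count_cat leq_addr.
  - by rewrite tp mulr0.
  - move=> m; rewrite !tp -natr1 mulrDr mulr1 lerDl ltW//= lerD2l.
    by rewrite -lee_fin -law_fineK// probability_le1.
  - rewrite (_ : (fun m => _) = (fun m => h * m%:R)); last exact/funext.
    apply: (cvg_comp (fun m => m%:R : R) (fun x => h * x) cvgr_idn).
    exact: gt0_cvgMry.
apply: filterS => w Dw.
have -> : (fun m => (count (fun z => z \in B) [seq Z i w | i <- iota 0 m])%:R / m%:R) =
    (fun m => h * (D m w / tsum (p m))).
  by apply/funext => m; rewrite -Dcount tp invfM [RHS]mulrCA mulVKf// gt_eqF.
rewrite -[X in _ --> X]mulr1; apply: cvgM => //; exact: cvg_cst.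
Qed.

Lemma point_masses (e : nat -> T) : injective e ->
  (forall j, measurable [set e j]) ->
  (\sum_(j <oo) (fine (H [set e j]))%:E = H (range e))%E.
Proof.
move=> einj me.
have -> : range e = \bigcup_j [set e j].
  by apply/seteqP; split=> x [j _]; [move=> <-|move=> ->]; exists j.
rewrite measure_semi_bigcup//; last exact: bigcupT_measurable.
  by apply: eq_eseriesr => j _; rewrite -law_fineK.
apply/trivIsetP => i j _ _ ij; rewrite -subset0 => x [-> /einj ejk].
by rewrite ejk eqxx in ij.
Qed.

(** Among the first [m] samples, those in the range of [e] take a number of values
    equal to the number of [j] such that [e j] has been seen. The events that [e j]
    and [e k] have both been missed have probability
    [(1 - (h j + h k)) ^+ m <= ((1 - h j) * (1 - h k)) ^+ m], so that seeing one
    point makes seeing the other less likely. *)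
Lemma distinct_sample_strong_law (e : nat -> T) : injective e ->
  (forall j, measurable [set e j]) ->
  occupancy (fun j => fine (H [set e j])) m @[m --> \oo] --> +oo ->
  {ae P, forall w,
    (size (undup [seq z <- [seq Z i w | i <- iota 0 m] | z \in range e]))%:R /
      occupancy (fun j => fine (H [set e j])) m @[m --> \oo] --> (1 : R)}.
Proof.
move=> einj me; set h := (fun j : nat => fine (H [set e j])) => hoo.
have hE j : H [set e j] = (h j)%:E by exact: law_fineK.
have h0 j : 0 <= h j by exact: fine_ge0.
have hsum : (\sum_(j <oo) (h j)%:E <= 1)%E.
  by rewrite point_masses// probability_le1//; exact: measurable_range_points.
have sh : nnsummable h by split=> //; apply: le_lt_trans hsum _; rewrite ltry.
have h1 j : h j <= 1 by rewrite -lee_fin -hE probability_le1.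
have th1 : tsum h <= 1 by rewrite -lee_fin tsumE.
pose g (y : T) : nat := xget 0%N [set j | e j = y].
have ge j : g (e j) = j.
  by rewrite /g; case: xgetP => [k _ /einj//|/(_ j)[]].
pose u m w := undup [seq z <- [seq Z i w | i <- iota 0 m] | z \in range e].
pose D m w : R := (size (u m w))%:R.
pose s m w := [seq g z | z <- u m w].
have uP m w z : z \in u m w -> e (g z) = z.
  by rewrite mem_undup mem_filter => /andP[/set_mem[j _ <-]]; rewrite ge.
have us m w : uniq (s m w).
  rewrite map_inj_in_uniq ?undup_uniq// => y z yu zu gyz.
  by rewrite -(uP _ _ _ yu) -(uP _ _ _ zu) gyz.
have sP m w j : reflect (exists2 i, (i < m)%N & Z i w = e j) (j \in s m w).
  apply: (iffP mapP) => [[z zu ->]|[i im Zi]].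
    rewrite (uP _ _ _ zu); move: zu; rewrite mem_undup mem_filter => /andP[_].
    by move=> /mapP[i]; rewrite mem_iota => im ->; exists i.
  exists (e j); last by rewrite ge.
  rewrite mem_undup mem_filter; apply/andP; split; first by apply/mem_set; exists j.
  by apply/mapP; exists i; rewrite ?mem_iota.
pose miss m B := \bigcap_(i in `I_m) Z i @^-1` (~` B).
have mmiss m B : measurable B -> measurable (miss m B).
  move=> mB; apply: fin_bigcap_measurable; first exact: finite_II.
  by move=> i _; apply: measurable_sample; exact: measurableC.
have Pmiss m B : measurable B -> P (miss m B) = ((1 - fine (H B)) ^+ m)%:E.
  move=> mB; rewrite sample_all; last exact: measurableC.
  by rewrite probability_setC// fineB// fin_num_measure.
pose E m j := ~` miss m [set e j].
have EP m j w : E m j w <-> j \in s m w.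
  split=> [nmiss|/sP[i im Zi]]; last by move=> /(_ i im); apply.
  apply/sP; apply: contrapT => nex; apply: nmiss => i /= im Zi.
  by apply: nex; exists i.
have Es m j w : \1_(E m j) w = (j \in s m w)%:R :> R.
  rewrite indicE; congr (nat_of_bool _)%:R; apply/idP/idP => [/set_mem/EP//|].
  by move=> /EP ?; exact: mem_set.
pose p m j := 1 - (1 - h j) ^+ m.
have mE m j : measurable (E m j) by apply: measurableC; exact: mmiss.
have PE m j : P (E m j) = (p m j)%:E.
  rewrite /E probability_setC; last exact: mmiss.
  by rewrite Pmiss.
have DE m w : ((D m w)%:E = \sum_(j <oo) (\1_(E m j) w : R)%:E)%E.
  under eq_eseriesr do rewrite Es.
  by rewrite nneseries_mem_uniq// size_map.
have sp m : nnsummable (p m) by exact: summable_occupancy.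
have corr m j k : j != k -> (P (E m j `&` E m k) <= (p m j * p m k)%:E)%E.
  move=> jk; rewrite /E -setCU probability_setC; last first.
    by apply: measurableU; exact: mmiss.
  have djk : [set e j] `&` [set e k] = set0.
    by rewrite -subset0 => x [-> /einj ejk]; rewrite ejk eqxx in jk.
  have mjk : measurable ([set e j] `|` [set e k]) by exact: measurableU.
  have Hjk : H ([set e j] `|` [set e k]) = (h j + h k)%:E.
    by rewrite EFinD -!hE; exact: measureU.
  have hjk : h j + h k <= 1 by rewrite -lee_fin -Hjk probability_le1.
  have -> : P (miss m [set e j] `|` miss m [set e k]) =
      ((1 - h j) ^+ m + (1 - h k) ^+ m - (1 - (h j + h k)) ^+ m)%:E.
    transitivity (P (miss m [set e j]) + P (miss m [set e k])
        - P (miss m [set e j] `&` miss m [set e k]))%E.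
      apply: measureUfinl; [exact: mmiss|exact: mmiss|].
      by rewrite -ge0_fin_numE// fin_num_measure//; exact: mmiss.
    rewrite !Pmiss// (_ : _ `&` _ = miss m ([set e j] `|` [set e k])).
      by rewrite Pmiss// Hjk.
    by rewrite /miss -bigcapI; apply: eq_bigcapr => i _; rewrite setCU.
  rewrite -EFinB lee_fin /p.
  have : (1 - (h j + h k)) ^+ m <= ((1 - h j) * (1 - h k)) ^+ m.
    rewrite lerXn2r ?nnegrE ?mulr_ge0 ?subr_ge0//.
    by have := mulr_ge0 (h0 j) (h0 k); lra.
  rewrite exprMn; lra.
apply: (occurrence_strong_law mE PE sp DE corr) => //.
- move=> m w; rewrite ler_nat; apply: uniq_leq_size; first exact: undup_uniq.
  move=> z; rewrite !mem_undup !mem_filter => /andP[-> /mapP[i]].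
  rewrite mem_iota => /andP[_ im] ->; rewrite andTb; apply/mapP; exists i => //.
  by rewrite mem_iota; exact: ltnW im.
- exact: occupancy0.
- move=> m; apply/andP; split.
    apply: le_tsum => // j; rewrite lerD2l lerN2 exprS ler_piMl//.
      by rewrite exprn_ge0// subr_ge0.
    by rewrite gerBl.
  apply: (@le_trans _ _ (tsum (p m) + tsum h)); last by rewrite lerD2l.
  rewrite -tsumD//; apply: le_tsum => //; first exact: nnsummableD.
  move=> j /=; rewrite /p exprS.
  have : h j * (1 - h j) ^+ m <= h j by rewrite ler_piMr// exprn_ile1 ?subr_ge0 ?gerBl.
  lra.
Qed.
End Sampling.

(** * Atoms of a law *)

Section Atoms.
Context {R : realType} {X : ptopologicalType}.
Hypothesis polishX : polish R X.
Variable H : probability (borel X) R.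

Let mset1 (y : borel X) : measurable [set y] := measurable_singleton polishX y.

(** There are at most [r^-1] such points, since their masses sum to at most [1]. *)
Lemma finite_heavy_points (r : R) : 0 < r ->
  finite_set [set y : borel X | r <= fine (H [set y])].
Proof.
move=> r0; apply: contrapT => /(infinite_set_fset (Num.bound r^-1))[B Bsub Bcard].
have mB : measurable (\big[setU/set0]_(y <- B) [set y]) by exact: bigsetU_measurable.
have := probability_le1 H mB.
rewrite measure_fbigsetU//; last first.
  by apply/trivIsetP => y z _ _ yz; rewrite -subset0 => t [-> zy]; rewrite zy eqxx in yz.
apply/negP; rewrite -ltNge.
have B0 : (1 < (\sum_(y <- B) r)%:E)%E.
  rewrite lte_fin big_const_seq count_predT iter_addr_0 -mulr_natl -ltr_pdivrMr// div1r.
  apply: lt_le_trans (archi_boundP _) _; first by rewrite invr_ge0 ltW.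
  by rewrite ler_nat.
apply: (lt_le_trans B0); rewrite -sumEFin big_seq [leRHS]big_seq.
apply: lee_sum => y yB; rewrite -[leRHS]fineK ?fin_num_measure// lee_fin.
exact: Bsub.
Qed.

Lemma countable_atoms : countable (atoms H).
Proof.
have -> : atoms H = \bigcup_n [set y : borel X | n.+1%:R^-1 <= fine (H [set y])].
  apply/seteqP; split=> [y Hy|y [n _ /= ny]].
    have fy : 0 < fine (H [set y]) by rewrite fine_gt0// Hy/= ltey_eq fin_num_measure.
    exists (Num.bound (fine (H [set y]))^-1) => //=.
    rewrite invf_ple ?posrE//.
    apply: (@le_trans _ _ (Num.bound (fine (H [set y]))^-1)%:R).
      by apply/ltW/archi_boundP; rewrite invr_ge0 ltW.
    by rewrite ler_nat.
  rewrite /atoms /= -[H _]fineK ?fin_num_measure// lte_fin.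
  by apply: lt_le_trans ny; rewrite invr_gt0.
apply: bigcup_countable => // n _; apply: finite_set_countable.
by apply: finite_heavy_points; rewrite invr_gt0.
Qed.

Lemma measurable_atoms : measurable (atoms H).
Proof. exact: countable_measurable mset1 countable_atoms. Qed.

(** Enumerating the atoms without repetition by all the natural numbers turns
    [atom_count] into [frequent_count] of a sequence of weights. *)
Lemma atom_enumeration : infinite_set (atoms H) ->
  exists2 e : nat -> borel X, injective e & range e = atoms H.
Proof.
move=> inf; have := eq_card_nat countable_atoms inf.
rewrite card_eq_sym => /card_set_bijP[e [sub inj surj]].
exists e; first by move=> i j; apply: inj; rewrite inE.
by apply/seteqP; split=> [y [j _ <-]|]; [exact: sub|exact: surj].
Qed.

Section Enumerated.
Variable e : nat -> borel X.
Hypotheses (einj : injective e) (eatoms : range e = atoms H).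

Let h j := fine (H [set e j]).

Lemma atom_weight_gt0 j : 0 < h j.
Proof.
have : atoms H (e j) by rewrite -eatoms; exists j.
by rewrite /atoms/= => ej; rewrite fine_gt0// ej/= ltey_eq fin_num_measure.
Qed.

Lemma atom_weight_sum : nnsummable h /\ tsum h = atomic_mass H.
Proof.
have sumE := point_masses H einj (fun j => mset1 (e j)).
have ma : measurable (range e) by rewrite eatoms; exact: measurable_atoms.
split; last by rewrite /tsum sumE eatoms.
split=> [j|]; rewrite ?ltW ?atom_weight_gt0//.
by rewrite sumE -ge0_fin_numE// fin_num_measure.
Qed.

Lemma atom_count_frequent (x : R) : 0 < atomic_mass H -> 0 < x ->
  (atom_count H x)%:R = frequent_count (fun j => h j / atomic_mass H) x.
Proof.
move=> a0 x0; pose p j := h j / atomic_mass H.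
have [sh _] := atom_weight_sum.
have sp : nnsummable p.
  rewrite (_ : p = fun j => (atomic_mass H)^-1 * h j); last first.
    by apply/funext => j; rewrite mulrC.
  by apply: nnsummableZ => //; rewrite invr_ge0 ltW.
pose J := [set j | 1 / x <= p j].
have fJ : finite_set J.
  have x0' : 0 < 1 / x by rewrite divr_gt0.
  have [N _ NP] := cvgr_lt _ (nnsummable_cvg0 sp) _ x0'.
  apply: (sub_finite_set (B := `I_N)); last exact: finite_II.
  move=> j /= pj; rewrite ltnNge; apply/negP => /NP /=.
  by rewrite ltNge pj.
have -> : atom_count H x = size (fset_set J).
  rewrite /atom_count (_ : [set y | _ /\ _] = e @` J); last first.
    apply/seteqP; split=> [y [] |y [j Jj <-]].
      by rewrite -eatoms => -[j _ <-] ej; exists j.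
    by split=> //; rewrite -eatoms; exists j.
  by rewrite fset_set_image// card_imfset.
rewrite -tsum_mem_uniq ?fset_uniq//; congr tsum; apply/funext => j.
congr (nat_of_bool _)%:R; rewrite in_fset_set//.
by apply/idP/idP => [/set_mem|] //; rewrite inE.
Qed.

End Enumerated.
End Atoms.

(** * Distinct samples when part of the law is diffuse *)

Lemma size_undup_filter (T : eqType) (B : pred T) (s : seq T) :
  size (undup s) =
    (size (undup [seq x <- s | B x]) + size (undup [seq x <- s | ~~ B x]))%N.
Proof. by rewrite -!filter_undup !size_filter count_predC. Qed.

Section DistinctSamples.
Context {d : measure_display} {Omega : measurableType d} {R : realType}.
Context {X : ptopologicalType}.
Hypothesis polishX : polish R X.
Variables (P : probability Omega R) (H : probability (borel X) R).
Variable Z : nat -> {mfun Omega >-> borel X}.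
Hypothesis iidZ : iid_with_law P H Z.
Variable e : nat -> borel X.
Hypotheses (einj : injective e) (eatoms : range e = atoms H).

Let h j := fine (H [set e j]).
Let mset1 (y : borel X) : measurable [set y] := measurable_singleton polishX y.

Let tail J : set (borel X) := range (fun j => e (j + J)%N).

Let measurable_tail J : measurable (tail J).
Proof. exact: measurable_range_points. Qed.

Let tail_gt0 J : 0 < fine (H (tail J)).
Proof.
apply: lt_le_trans (atom_weight_gt0 polishX eatoms J) _.
have mJ := measurable_tail J.
rewrite -lee_fin -!law_fineK//; apply: le_measure; rewrite ?inE//.
by move=> _ ->; exists 0%N.
Qed.

Let tail_cvg0 : fine (H (tail J)) @[J --> \oo] --> 0.
Proof.
have [[h0 hoo] _] := atom_weight_sum polishX einj eatoms.
have := nneseries_tail_cvg hoo (fun j _ => h0 j : (0 <= (h j)%:E)%E).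
rewrite (_ : (fun J => _) = (fun J => H (tail J))).
  by move=> /fine_cvg.
apply/funext => J; rewrite -nneseries_addn; last by move=> j; rewrite lee_fin.
rewrite -(point_masses H)//; first by move=> i j /einj/eqP; rewrite eqn_add2r => /eqP.
Qed.

(** Let [N m] be the number of nonatomic samples among the first [m], and [C J m]
    the number of those at atoms of rank at least [J]. As nonatomic samples do not
    repeat, the number of distinct values lies between [N m] and [N m + J + C J m]. *)
Lemma distinct_sample_linear :
  atomic_mass H < 1 ->
  {ae P, forall w,
    (size (undup [seq Z i w | i <- iota 0 m]))%:R / m%:R @[m --> \oo]
      --> 1 - atomic_mass H}.
Proof.
move=> a1.
have matoms := measurable_atoms polishX H.
have aE : H (atoms H) = (atomic_mass H)%:E by rewrite fineK// fin_num_measure.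
have mB0 : measurable (~` atoms H) by exact: measurableC.
have HB0 : fine (H (~` atoms H)) = 1 - atomic_mass H.
  by rewrite probability_setC// aE.
have freq0 : {ae P, forall w,
    (count (fun z => z \in ~` atoms H) [seq Z i w | i <- iota 0 m])%:R / m%:R
      @[m --> \oo] --> 1 - atomic_mass H}.
  by rewrite -HB0; apply: sample_frequency => //; rewrite HB0 subr_gt0.
have freqJ : {ae P, forall w J,
    (count (fun z => z \in tail J) [seq Z i w | i <- iota 0 m])%:R / m%:R
      @[m --> \oo] --> fine (H (tail J))}.
  apply: ae_foralln => J; apply: sample_frequency => //.
have dist : {ae P, forall w i k, i != k -> (~` atoms H) (Z i w) -> Z i w <> Z k w}.
  apply: (samples_distinct iidZ mB0 (measurable_diagonal polishX)).
  move=> x nx; apply/eqP; rewrite eq_le measure_ge0 andbT leNgt.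
  by apply/negP => Hx; apply: nx.
apply: filterS3 freq0 freqJ dist => w freq0 freqJ dist.
pose s m := [seq Z i w | i <- iota 0 m].
pose N m := count (fun z => z \in ~` atoms H) (s m).
pose C J m := count (fun z => z \in tail J) (s m).
have Nle m : (N m <= size (undup (s m)))%N.
  rewrite (size_undup_filter (fun z => z \in ~` atoms H)) /N -size_filter.
  rewrite (@undup_id _ [seq z <- s m | _]) ?leq_addr// /s filter_map.
  rewrite map_inj_in_uniq ?filter_uniq ?iota_uniq// => i k.
  rewrite mem_filter => /andP[/set_mem Ai _] _ Zik; apply/eqP.
  by apply: contraPT Zik => /dist; apply.
have leN J m : (size (undup (s m)) <= N m + J + C J m)%N.
  rewrite (size_undup_filter (fun z => z \in ~` atoms H)) -addnA.
  apply: leq_add; first by rewrite /N -size_filter size_undup.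
  rewrite (size_undup_filter (fun z => z \in tail J)) addnC.
  apply: leq_add; last first.
    rewrite (leq_trans (size_undup _))// size_filter /C count_filter.
    by apply: sub_count => z /= /andP[].
  rewrite -[leqRHS](size_iota 0) -(size_map e); apply: uniq_leq_size.
    exact: undup_uniq.
  move=> z; rewrite mem_undup !mem_filter => /and3P[ntail].
  rewrite in_setC negbK -eatoms => /set_mem[j _ ze] _; rewrite -ze in ntail *.
  apply: map_f; rewrite mem_iota add0n /= ltnNge; apply: contraNN ntail => Jj.
  by apply/mem_set; exists (j - J)%N => //; rewrite subnK.
apply/cvgrPdist_le => eps eps0.
have eps4 : 0 < eps / 4 by rewrite divr_gt0.
have [J _ /(_ J (leqnn J)) hJ] := cvgr_lt _ tail_cvg0 _ eps4.
have e0 : \forall m \near \oo, `|1 - atomic_mass H - (N m)%:R / m%:R| < eps / 4.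
  by move/cvgrPdist_lt : freq0; apply.
have eC : \forall m \near \oo, (C J m)%:R / m%:R < eps / 4.
  by apply: (cvgr_lt _ (freqJ J)).
have eJ : \forall m \near \oo, J%:R / m%:R < eps / 4.
  have : J%:R * (m%:R)^-1 @[m --> \oo] --> (J%:R * 0 : R).
    apply: cvgM; first exact: cvg_cst.
    apply/gtr0_cvgV0; last exact: cvgr_idn.
    by exists 1%N => // m /= m1; rewrite ltr0n.
  by rewrite mulr0 => cJ; apply: (cvgr_lt _ cJ).
near=> m.
have m0 : 0 < (m%:R)^-1 :> R.
  by rewrite invr_gt0 ltr0n; near: m; exact: nbhs_infty_gt.
have lo : (N m)%:R / m%:R <= (size (undup (s m)))%:R / m%:R :> R.
  by rewrite ler_pM2r// ler_nat.
have hi : (size (undup (s m)))%:R / m%:R <=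
    (N m)%:R / m%:R + J%:R / m%:R + (C J m)%:R / m%:R :> R.
  by rewrite -!mulrDl ler_pM2r// -!natrD ler_nat.
have : `|1 - atomic_mass H - (N m)%:R / m%:R| < eps / 4 by near: m.
have : (C J m)%:R / m%:R < eps / 4 :> R by near: m.
have : J%:R / m%:R < eps / 4 :> R by near: m.
move: lo hi; rewrite ltr_norml ler_norml -/(s m).
move: (_ / m%:R) (J%:R / _) (_ / m%:R) (_ / m%:R) => r1 r2 r3 r4.
lra.
Unshelve. all: by end_near. Qed.

End DistinctSamples.

(** * Growth of the number of blocks *)

Theorem theorem8 (R : realType) (d : measure_display) (Omega : measurableType d)
    (P : probability Omega R) (X : ptopologicalType) (polishX : polish R X)
    (H : probability (borel X) R)
    (Pi : forall n, Omega -> {set {set 'I_n}}) (q : seq nat -> R)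
    (rpPi : random_partition Pi) (exchPi : exchangeable P Pi)
    (eppfPi : is_eppf P Pi q) (properPi : proper_frequencies P Pi)
    (Z : nat -> {mfun Omega >-> borel X}) (iidZ : iid_with_law P H Z)
    (indepZPi : independent_systems P
       (sigma_sequence (fun n => Z n : Omega -> borel X)) (sigma_partition Pi))
    (tPi : forall n, Omega -> {set {set 'I_n}})
    (tPiE : forall n w,
       tPi n w = induced_partition (fun i => Z (block_index Pi i w) w) n)
    (a : R) (aE : a = atomic_mass H) (a_gt0 : 0 < a)
    (c : nat -> R) (c_gt0 : forall n, (0 < n)%N -> 0 < c n)
    (c_cvg : c @ \oo --> +oo)
    (S : {mfun Omega >-> R}) (S_gt0 : {ae P, forall w, 0 < S w})
    (PiS : {ae P, forall w, #|Pi n w|%:R / c n @[n --> \oo] --> S w})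
    (sigma0 : R) (sigma0_01 : 0 <= sigma0 <= 1)
    (lstar : R -> R) (lstar_sv : slowly_varying lstar)
    (alphaE : forall x : R, 0 < x ->
       (atom_count H x)%:R = x `^ sigma0 * lstar x)
    (lstar_pinfty : sigma0 = 0 -> lstar x @[x --> +oo] --> +oo) :
  [/\ sigma0 = 1 -> forall x : R, 0 < x ->
        (\int[lebesgue_measure]_(u in `[x, +oo[) (u^-1 * lstar u)%:E < +oo)%E,
      a < 1 ->
        {ae P, forall w, #|tPi n w|%:R / c n @[n --> \oo] --> (1 - a) * S w}
    & a = 1 ->
        {ae P, forall w,
          #|tPi n w|%:R / (c n `^ sigma0 * ell0 sigma0 lstar (c n))
            @[n --> \oo] --> z0 sigma0 * S w `^ sigma0}].
Proof.
pose V0 x : R := (atom_count H x)%:R.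
have [V0pos V0rv] := slowly_varying_regularly_varying alphaE lstar_sv.
have s_ge0 : 0 <= sigma0 by have /andP[] := sigma0_01.
(* The counting function of the atoms is unbounded: by regular variation if
   [sigma0 > 0], and because of [lstar] if [sigma0 = 0]. *)
have unbounded A : exists2 x : R, 0 < x & A <= V0 x.
  have [s0|sn0] := eqVneq sigma0 0; last first.
    by apply: (regularly_varying_unbounded _ V0pos V0rv); rewrite lt_def sn0.
  have lge : \forall x \near +oo, A <= lstar x.
    by apply: (cvgryPge _).1; exact: lstar_pinfty.
  have [x [x0 lx]] : exists x : R, 0 < x /\ A <= lstar x.
    near (pinfty_nbhs R) => x; exists x; split; near: x => //.
    exact: nbhs_pinfty_gt.
  by exists x => //; rewrite /V0 alphaE// s0 powRr0 mul1r.
have inf : infinite_set (atoms H).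
  move=> fin; have [x x0] := unbounded (#|` fset_set (atoms H)|.+1%:R).
  rewrite ler_nat ltnNge => /negP; apply.
  have sub : [set y | atoms H y /\ 1 / x <= fine (H [set y]) / atomic_mass H]
      `<=` atoms H.
    by move=> y [].
  apply: fsubset_leq_card; rewrite -fset_set_sub//.
  exact: sub_finite_set sub fin.
have matoms := measurable_atoms polishX H.
have [e einj eatoms] := atom_enumeration polishX inf.
pose h j := fine (H [set e j]).
have [sh th] := atom_weight_sum polishX einj eatoms.
pose p j := h j / a.
have pE : p = (fun j => a^-1 * h j) by apply/funext => j; rewrite mulrC.
have sp : nnsummable p by rewrite pE; apply: nnsummableZ => //; rewrite invr_ge0 ltW.
have VE (x : R) : 0 < x -> frequent_count p x = x `^ sigma0 * lstar x.
  move=> x0; rewrite -alphaE// (atom_count_frequent polishX einj eatoms)// -?aE//.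
have [Vpos Vrv] := slowly_varying_regularly_varying VE lstar_sv.
have Vmono (x y : R) : 0 < x -> x <= y -> frequent_count p x <= frequent_count p y.
  exact: le_frequent_count.
have Voo : frequent_count p x @[x --> +oo] --> +oo.
  apply/cvgryPge => A; have [y y0 Ay] := unbounded A.
  near=> x; have yx : y <= x by near: x; apply: nbhs_pinfty_ge; exact: num_real.
  apply: le_trans (Vmono _ _ y0 yx); rewrite VE// -alphaE//.
(* When [sigma0 = 1], [frequent_count p u] is [u * lstar u], and this is
   [capped_mass_integral]. *)
have capE (x : R) : 0 < x -> sigma0 = 1 ->
    (\int[lebesgue_measure]_(u in `[x, +oo[) (u^-1 * lstar u)%:E =
      (x^-1 * capped_mass p x)%:E)%E.
  move=> x0 s1; rewrite -capped_mass_integral//; apply: eq_integral => u.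
  rewrite inE/= in_itv/= andbT => xu; have u0 : 0 < u by exact: lt_le_trans xu.
  congr EFin; rewrite VE// s1 powRr1 ?ltW// expr2 invfM mulrA mulfVK ?gt_eqF//.
have KE n w : #|tPi n w| = size (undup [seq Z k w | k <- iota 0 #|Pi n w|]).
  rewrite tPiE card_induced_partition.
  have [_ part restr] := rpPi.
  exact: (size_undup_block_indices (fun n => part n w)
    (fun m n mn => restr m n mn w) (fun k => Z k w : borel X)).
split.
- by move=> s1 x x0; rewrite capE// ltry.
- move=> a1.
  have lin : {ae P, forall w, (size (undup [seq Z i w | i <- iota 0 m]))%:R / m%:R
      @[m --> \oo] --> 1 - a}.
    by rewrite aE; apply: (distinct_sample_linear polishX iidZ einj eatoms); rewrite -aE.
  apply: filterS3 lin PiS S_gt0 => w lin Kc S0.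
  have Koo := index_cvg_infty c_cvg Kc S0.
  have linK := cvg_comp _ _ Koo lin.
  have : (#|tPi n w|%:R / #|Pi n w|%:R) * (#|Pi n w|%:R / c n)
      @[n --> \oo] --> (1 - a) * S w.
    apply: cvgM => //; under eq_fun do rewrite KE; exact: linK.
  apply: cvg_trans; apply: near_eq_cvg; near=> n.
  have K0 : #|Pi n w|%:R != 0 :> R.
    rewrite pnatr_eq0 -lt0n; near: n; exact: (Koo _ (nbhs_infty_gt 0)).
  by rewrite /= mulrA divfK.
move=> a1.
have hp : p = h by apply/funext => j; rewrite /p a1 divr1.
have p1 j : p j <= 1.
  have mj := measurable_singleton polishX (e j).
  by rewrite hp -lee_fin -law_fineK// probability_le1.
have occoo : occupancy p m @[m --> \oo] --> +oo.
  apply/cvgryPge => A.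
  have VA : \forall m \near \oo, 2 * A <= frequent_count p m%:R.
    have VA' : \forall x \near +oo, 2 * A <= frequent_count p x.
      by apply: (cvgryPge _).1.
    have idoo : m%:R @[m --> \oo] --> (+oo : set_system R) by exact: cvgr_idn.
    exact: (idoo _ VA').
  near=> m; have m0 : (0 < m)%N by near: m; exact: nbhs_infty_gt.
  apply: le_trans (occupancy_ge_frequent sp p1 m0).
  by rewrite ler_pdivlMl//; near: m.
have occ0 : \forall m \near \oo, 0 < occupancy p m by apply: (cvgryPgt _).1.
have Docc : {ae P, forall w, (size (undup [seq Z i w | i <- iota 0 m]))%:R /
    occupancy p m @[m --> \oo] --> (1 : R)}.
  have hits : {ae P, forall w,
    (size (undup [seq z <- [seq Z i w | i <- iota 0 m] | z \in range e]))%:R /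
      occupancy p m @[m --> \oo] --> (1 : R)}.
    rewrite hp; apply: (distinct_sample_strong_law iidZ einj); rewrite -?/h -?hp//.
    by move=> j; exact: (measurable_singleton polishX).
  have atomic : {ae P, forall w i, atoms H (Z i w)}.
    apply: ae_foralln => i; exists (Z i @^-1` (~` atoms H)); split => //.
      by apply: measurable_sample; exact: measurableC.
    rewrite [LHS](sample_law iidZ); last exact: measurableC.
    rewrite probability_setC// -[X in (_ - X)%E]fineK ?fin_num_measure//.
    by rewrite -/(atomic_mass H) -aE a1 subee.
  apply: filterS2 hits atomic => w hits atomic.
  rewrite (_ : (fun m => _) = (fun m => (size (undup
      [seq z <- [seq Z i w | i <- iota 0 m] | z \in range e]))%:R / occupancy p m)) //.
  apply/funext => m; congr (_%:R / _); congr (size (undup _)).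
  apply/esym/all_filterP/allP => _ /mapP[i _ ->]; apply/mem_set.
  by rewrite eatoms; exact: atomic.
apply: filterS3 Docc PiS S_gt0 => w Docc Kc S0.
have Koo := index_cvg_infty c_cvg Kc S0.
have cpos : \forall n \near \oo, 0 < c n by apply: (cvgryPgt c).1.
have [s1|sn1] := eqVneq sigma0 1.
  have Vrv1 : regularly_varying 1 (frequent_count p) by rewrite -s1.
  have := growth_along_index (le_capped_mass sp) (capped_pos sp Vpos)
    (capped_regularly_varying sp Vpos Vrv1) occ0 Docc
    (occupancy_capped_asymp sp p1 Vpos Vrv1)
    c_cvg Kc S0 Koo.
  rewrite /z0 s1 eqxx; apply: cvg_trans; apply: near_eq_cvg; near=> n.
  have c0 : 0 < c n by near: n.
  rewrite /= KE powRr1 ?ltW// /ell0 eqxx /Rintegral capE//=.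
  by rewrite mulVKf// gt_eqF.
have s_lt1 : sigma0 < 1 by rewrite lt_neqAle sn1; have /andP[] := sigma0_01.
have := growth_along_index Vmono Vpos Vrv occ0 Docc
  (occupancy_frequent_asymp sp p1 s_lt1 Vpos Vrv)
  c_cvg Kc S0 Koo.
rewrite /z0 (negbTE sn1); apply: cvg_trans; apply: near_eq_cvg; near=> n.
have c0 : 0 < c n by near: n.
by rewrite /= KE /ell0 (negbTE sn1) VE.
Unshelve. all: by end_near. Qed.
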